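(* Let $A=(KQ/\mathcal{I},\leqslant)$ be a 1-quasi-hereditary algebra and $j,k\in Q_0$. For any $i\in\Lambda^{(j)}\cap\Lambda^{(k)}$ fix a path of the form $p(j,i,k)$. Then the set $\{p(j,i,k)\mid i\in\Lambda^{(j)}\cap\Lambda^{(k)}\}$ is a $K$-basis of $P(j)_k$. In particular (fixing such a path for every occurring triple), $\mathfrak{B}_j:=\{p(j,i,k)\mid i\in\Lambda^{(j)},\ k\in\Lambda_{(i)}\}$ is a $K$-basis of $P(j)$ for every $j\in Q_0$, and $\mathfrak{B}:=\{p(j,i,k)\mid j,k\in Q_0,\ i\in\Lambda^{(j)}\cap\Lambda^{(k)}\}$ is a $K$-basis of $A$.
   Context: $K$ is an algebraically closed field, $Q$ is a finite quiver with vertex set $Q_0$, and $KQ/\mathcal{I}$ is a finite-dimensional bound quiver algebra ($\mathcal{I}$ an admissible ideal). Modules are finite-dimensional left modules. Paths are composed so that a path from $j$ to $k$ lies in $e_kAe_j$; thus $P(j)=Ae_j$ and $P(j)_k=e_kAe_j$. For $i\in Q_0$, $S(i)$, $P(i)$, $I(i)$ denote the simple, projective indecomposable and injective indecomposable module at $i$; $[M:S(i)]$ is the Jordan-Hölder multiplicity. Let $\leqslant$ be a partial order on $Q_0$. The standard module $\Delta(i)$ is the largest factor module of $P(i)$ with $[\Delta(i):S(j)]=0$ for all $j\not\leqslant i$; the costandard module $\nabla(i)$ is the largest submodule of $I(i)$ with $[\nabla(i):S(j)]=0$ for all $j\not\leqslant i$. A module is $\Delta$-good if it has a filtration with all subquotients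 isomorphic to standard modules, and $(M:\Delta(i))$ is the (well-defined) number of subquotients isomorphic to $\Delta(i)$. $(KQ/\mathcal{I},\leqslant)$ is quasi-hereditary if for all $i,j\in Q_0$: $[\Delta(i):S(i)]=1$, and $P(i)$ is $\Delta$-good with $(P(i):\Delta(j))=0$ for $j\not\geqslant i$ and $(P(i):\Delta(i))=1$. A quasi-hereditary algebra $A=(KQ/\mathcal{I},\leqslant)$ is 1-quasi-hereditary if for all $i,j\in Q_0=\{1,\ldots,n\}$: (1) there is a smallest and a largest element with respect to $\leqslant$, denoted $1$ and $n$ respectively; (2) $[\Delta(i):S(j)]=(P(j):\Delta(i))=1$ for $j\leqslant i$; (3) $\operatorname{soc}P(j)\cong\operatorname{top}I(j)\cong S(1)$; (4) there are an injection $\Delta(i)\hookrightarrow\Delta(n)$ and a surjection $\nabla(n)\twoheadrightarrow\nabla(i)$. $\Lambda_{(j)}=\{i\in Q_0\mid i\leqslant j\}$ and $\Lambda^{(j)}=\{i\in Q_0\mid i\geqslant j\}$. The quiver $Q$ of a 1-quasi-hereditary algebra has arrows exactly between neighbours with respect to $\leqslant$, one in each direction. For $i\in\Lambda^{(j)}\cap\Lambda^{(k)}$, $p(j,i,k)$ denotes the image in $A$ of a path from $j$ to $k$ obtained by concatenating an increasing path from $j$ to $i$ (vertices increasing with respect to $\leqslant$) with a decreasing path from $i$ to $k$ (vertices decreasing); $p(j,j,j)=e_j$. Such a path always exists but need not be unique. *)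

(* Defs.v *)
From HB Require Import structures.
From mathcomp Require Import all_boot all_order all_algebra all_field.
From mathcomp Require Import finmap.
From mathcomp Require Import boolp.
From mathcomp.multinomials Require Import monalg.

Set Implicit Arguments.
Unset Strict Implicit.
Unset Printing Implicit Defensive.

Import GRing.Theory.
Local Open Scope ring_scope.

Record quiver (V : finType) := Quiver {
  arrow : finType;
  src : arrow -> V;
  tgt : arrow -> V
}.
Arguments src {V} Q a : rename.
Arguments tgt {V} Q a : rename.

Section Paths.
Variables (V : finType) (Q : quiver V).

Fixpoint walk (x : V) (s : seq (arrow Q)) : bool :=
  if s is a :: s' then (src Q a == x) && walk (tgt Q a) s' else true.

(* A path is its start vertex with its arrows, in order of traversal. *)
Record qpath := QPath { pval : V * seq (arrow Q); _ : walk pval.1 pval.2 }.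
HB.instance Definition _ := [isSub for pval].
HB.instance Definition _ := [Choice of qpath by <:].

Definition psrc (p : qpath) : V := (pval p).1.
Definition parr (p : qpath) : seq (arrow Q) := (pval p).2.
Definition ptgt (p : qpath) : V := last (psrc p) (map (tgt Q) (parr p)).

Definition triv (x : V) : qpath := @QPath (x, [::]) isT.

Fact walk_arrow (a : arrow Q) : walk (src Q a, [:: a]).1 (src Q a, [:: a]).2.
Proof. by rewrite /= eqxx. Qed.

Definition arrow_path (a : arrow Q) : qpath := @QPath (src Q a, [:: a]) (walk_arrow a).

(* "First q, then p"; None when the paths cannot be composed. *)
Definition pcomp (p q : qpath) : option qpath :=
  if ptgt q == psrc p then insub (psrc q, parr q ++ parr p) else None.

Lemma walk_cat x s t :
  walk x (s ++ t) = walk x s && walk (last x (map (tgt Q) s)) t.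
Proof. by elim: s x => //= a s IH x; rewrite IH andbA. Qed.

Lemma pcompP (p q : qpath) : ptgt q = psrc p ->
  exists r, [/\ pcomp p q = Some r, psrc r = psrc q & parr r = parr q ++ parr p].
Proof.
move=> e; rewrite /pcomp e eqxx.
have h : walk (psrc q, parr q ++ parr p).1 (psrc q, parr q ++ parr p).2.
  by rewrite /= walk_cat (valP q) -/(ptgt q) e (valP p).
by exists (QPath h); rewrite insubT.
Qed.

Lemma pcomp_None (p q : qpath) : ptgt q != psrc p -> pcomp p q = None.
Proof. by rewrite /pcomp => /negbTE->. Qed.

Lemma pcomp_Some (p q r : qpath) : pcomp p q = Some r ->
  [/\ ptgt q = psrc p, psrc r = psrc q & parr r = parr q ++ parr p].
Proof.
have [e|/pcomp_None h] := eqVneq (ptgt q) (psrc p); last by rewrite h.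
by have [r'' [-> ? ?]] := pcompP e; case=> <-.
Qed.

Lemma qpath_eq (p q : qpath) : psrc p = psrc q -> parr p = parr q -> p = q.
Proof.
move=> h1 h2; apply: val_inj; move: h1 h2; rewrite /psrc /parr.
by case: p q => [[? ?] ?] [[? ?] ?] /= -> ->.
Qed.

Lemma pcompA (p q r : qpath) :
  obind (pcomp p) (pcomp q r) = obind (fun t => pcomp t r) (pcomp p q).
Proof.
have tgtE t u v : pcomp t u = Some v -> ptgt v = ptgt t.
  case/pcomp_Some=> e h1 h2.
  by rewrite /ptgt h1 h2 map_cat last_cat -/(ptgt u) e.
have [e1|n1] := eqVneq (ptgt r) (psrc q); last first.
  rewrite (pcomp_None n1) /=; case E: (pcomp p q) => [t|] //=.
  by have [_ h _] := pcomp_Some E; rewrite pcomp_None // h.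
have [u [E1 hu1 hu2]] := pcompP e1; rewrite E1 /=.
have [e2|n2] := eqVneq (ptgt q) (psrc p); last first.
  by rewrite (pcomp_None n2) /= pcomp_None // (tgtE _ _ _ E1).
have [v [E2 hv1 hv2]] := pcompP e2; rewrite E2 /=.
have e3 : ptgt u = psrc p by rewrite (tgtE _ _ _ E1).
have e4 : ptgt r = psrc v by rewrite hv1.
have [w [-> hw1 hw2]] := pcompP e3; have [z [-> hz1 hz2]] := pcompP e4.
congr Some; apply: qpath_eq; first by rewrite hw1 hu1 hz1.
by rewrite hw2 hu2 hz2 hv2 catA.
Qed.

Lemma pcomp_trivl x (p : qpath) :
  pcomp (triv x) p = if x == ptgt p then Some p else None.
Proof.
have [->|n] := eqVneq x (ptgt p); last by rewrite pcomp_None // eq_sym.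
have [r [-> h1 h2]] := @pcompP (triv (ptgt p)) p erefl.
by congr Some; apply: qpath_eq => //; rewrite h2 cats0.
Qed.

Lemma pcomp_trivr x (p : qpath) :
  pcomp p (triv x) = if x == psrc p then Some p else None.
Proof.
have [->|n] := eqVneq x (psrc p); last by rewrite pcomp_None.
by have [r [-> h1 h2]] := @pcompP p (triv (psrc p)) erefl; congr Some; apply: qpath_eq.
Qed.

Lemma pcomp_eq_triv x (p q : qpath) :
  (pcomp p q == Some (triv x)) = (p == triv x) && (q == triv x).
Proof.
apply/eqP/andP => [/pcomp_Some[e h1 h2]|[/eqP-> /eqP->]]; last first.
  by rewrite pcomp_trivl eqxx.
move/esym/nilP: h2; rewrite /nilp size_cat addn_eq0 => /andP[/nilP hq /nilP hp].
have sq : psrc q = x by rewrite -h1.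
split; apply/eqP/qpath_eq => //.
by rewrite -e /ptgt hq sq.
Qed.

End Paths.

Definition pathalg (K : fieldType) (V : finType) (Q : quiver V) : Type :=
  {malg K[qpath Q]}.

HB.instance Definition _ (K : fieldType) (V : finType) (Q : quiver V) :=
  GRing.Lmodule.on (pathalg K Q).

HB.lock Definition path_elt (K : fieldType) (V : finType) (Q : quiver V)
  (p : qpath Q) : pathalg K Q := mkmalgU p 1.
Canonical path_elt_unlockable := Unlockable path_elt.unlock.

(* The K-linear extension of a map defined on paths. *)
HB.lock Definition pext (K : fieldType) (V : finType) (Q : quiver V)
  (f : qpath Q -> pathalg K Q) (x : pathalg K Q) : pathalg K Q :=
  \sum_(p <- msupp x) x@_p *: f p.
Canonical pext_unlockable := Unlockable pext.unlock.

Definition pmul (K : fieldType) (V : finType) (Q : quiver V) (p q : qpath Q) :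
  pathalg K Q := if pcomp p q is Some r then path_elt K r else 0.

HB.lock Definition kqmul (K : fieldType) (V : finType) (Q : quiver V)
  (x y : pathalg K Q) : pathalg K Q := pext (fun p => pext (pmul K p) y) x.
Canonical kqmul_unlockable := Unlockable kqmul.unlock.

Section PathAlgebra.
Variables (K : fieldType) (V : finType) (Q : quiver V).
Local Notation KQ := (pathalg K Q).
Local Notation path_elt := (@path_elt K V Q).
Local Notation pmul := (@pmul K V Q).
Local Notation kqmul := (@kqmul K V Q).
Implicit Types (f g : qpath Q -> KQ) (x y z : KQ) (p q r : qpath Q).

Lemma path_eltE p q : (path_elt p)@_q = (p == q)%:R.
Proof. by rewrite unlock; exact: mcoeffU. Qed.

Definition kqone : KQ := \sum_(v : V) path_elt (triv Q v).

Lemma pextE f x : pext f x = \sum_(p <- msupp x) x@_p *: f p.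
Proof. by rewrite unlock. Qed.

Lemma pextw f (x : KQ) (D : {fset qpath Q}) : (msupp x `<=` D)%fset ->
  pext f x = \sum_(p <- D) x@_p *: f p.
Proof.
move=> le; rewrite pextE; apply: big_fset_incl => // p _ /mcoeff_outdom->.
by rewrite scale0r.
Qed.

Lemma pext_is_linear f : linear (pext f).
Proof.
move=> c x y; pose D := (msupp x `|` msupp y `|` msupp (c *: x + y))%fset.
have h1 : (msupp x `<=` D)%fset by rewrite /D -fsetUA fsubsetUl.
have h2 : (msupp y `<=` D)%fset by rewrite /D fsetUAC fsubsetUr.
have h3 : (msupp (c *: x + y) `<=` D)%fset by rewrite fsubsetUr.
rewrite (pextw _ h1) (pextw _ h2) (pextw _ h3) scaler_sumr -big_split /=.
by apply: eq_bigr => p _; rewrite mcoeffD mcoeffZ scalerDl scalerA.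
Qed.

HB.instance Definition _ f :=
  GRing.isLinear.Build K KQ KQ _ (pext f) (pext_is_linear f).

Lemma eq_pext f g x : f =1 g -> pext f x = pext g x.
Proof. by move=> e; rewrite !pextE; apply: eq_bigr => p _; rewrite e. Qed.

Lemma pext_elt f p : pext f (path_elt p) = f p.
Proof.
rewrite (@pextw _ _ [fset p]%fset); last by rewrite path_elt.unlock msuppU_le.
by rewrite big_seq_fset1 path_eltE eqxx scale1r.
Qed.

Lemma pext_id x : pext path_elt x = x.
Proof.
rewrite pextE [RHS](@monalgEw _ _ x (msupp x)) //; apply: eq_bigr => p _.
apply/malgP => q; rewrite mcoeffZ path_eltE mcoeffU; exact: mulr_natr.
Qed.

Lemma pext_pext f g x : pext f (pext g x) = pext (fun p => pext f (g p)) x.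
Proof.
rewrite (pextE g) [RHS]pextE linear_sum; apply: eq_bigr => p _.
by rewrite linearZ.
Qed.

Lemma pext0 x : pext (fun=> 0) x = 0.
Proof. by rewrite pextE big1 // => p _; rewrite scaler0. Qed.

Lemma kqmulE x y : kqmul x y = pext (fun p => pext (pmul p) y) x.
Proof. by rewrite unlock. Qed.

Lemma kqmul_elt p q : kqmul (path_elt p) (path_elt q) = pmul p q.
Proof. by rewrite !kqmulE !pext_elt. Qed.

Lemma pmulA p q r : pext (pmul p) (pmul q r) = pext (pmul^~ r) (pmul p q).
Proof.
have l : pext (pmul p) (pmul q r) =
    if obind (pcomp p) (pcomp q r) is Some t then path_elt t else 0.
  rewrite {2}/pmul; case: (pcomp q r) => [t|] /=; [exact: pext_elt|exact: linear0].
have h : pext (pmul^~ r) (pmul p q) =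
    if obind (fun t => pcomp t r) (pcomp p q) is Some t then path_elt t else 0.
  rewrite {2}/pmul; case: (pcomp p q) => [t|] /=; last exact: linear0.
  exact: (pext_elt (pmul^~ r)).
by rewrite l h pcompA.
Qed.

Lemma kqmulA : associative kqmul.
Proof.
move=> x y z.
rewrite !kqmulE; pose G p q := pext (fun r => pext (pmul p) (pmul q r)) z.
transitivity (pext (fun p => pext (G p) y) x).
  apply: eq_pext => p; rewrite (pext_pext (pmul p) (fun q => pext (pmul q) z)).
  by apply: eq_pext => q; exact: (pext_pext (pmul p) (pmul q)).
rewrite (pext_pext (fun s => pext (pmul s) z) (fun p => pext (pmul p) y)).
apply: eq_pext => p.
rewrite (pext_pext (fun s => pext (pmul s) z) (pmul p)).
apply: eq_pext => q.
transitivity (pext (fun r => pext (pmul^~ r) (pmul p q)) z).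
  by apply: eq_pext => r; exact: pmulA.
rewrite /pmul; case: (pcomp p q) => [t|].
  rewrite (pext_elt (fun s => pext (pmul s) z)).
  by apply: eq_pext => r; exact: (pext_elt (pmul^~ r)).
have e : pext (fun s => pext (pmul s) z) 0 = 0 by exact: linear0.
rewrite [RHS]e -[RHS](pext0 z); apply: eq_pext => r; exact: linear0.
Qed.

Lemma kqmul1x : left_id kqone kqmul.
Proof.
move=> x; rewrite !kqmulE /kqone linear_sum -[RHS]pext_id [RHS]pextE.
under eq_bigr do rewrite /= pext_elt pextE.
rewrite exchange_big /=; apply: eq_bigr => p _; rewrite -scaler_sumr; congr (_ *: _).
under eq_bigr do rewrite /pmul pcomp_trivl (fun_if (fun o => if o is Some r then path_elt r else 0)).
by rewrite -big_mkcond big_pred1_eq.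
Qed.

Lemma kqmulx1 : right_id kqone kqmul.
Proof.
move=> x; rewrite !kqmulE /kqone -[RHS]pext_id; apply: eq_pext => p.
rewrite linear_sum; under eq_bigr do
  rewrite /= pext_elt /pmul pcomp_trivr (fun_if (fun o => if o is Some r then path_elt r else 0)).
by rewrite -big_mkcond big_pred1_eq.
Qed.

Lemma kqmulDl : left_distributive kqmul +%R.
Proof. by move=> x y z; rewrite !kqmulE linearD. Qed.

Lemma kqmulDr : right_distributive kqmul +%R.
Proof.
move=> x y z; rewrite !kqmulE !(pextE _ x) -big_split /=; apply: eq_bigr => p _.
by rewrite linearD scalerDr.
Qed.

(* Not an nzRingType: Q may have no vertices. *)
HB.instance Definition _ := GRing.Zmodule_isPzRing.Build KQ
  kqmulA kqmul1x kqmulx1 kqmulDl kqmulDr.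

Lemma pathalg1 : 1 = \sum_v path_elt (triv Q v) :> KQ.
Proof. by []. Qed.

Lemma pathalgM x y : x * y = pext (fun p => pext (pmul p) y) x.
Proof. exact: kqmulE. Qed.

Lemma path_eltM p q : path_elt p * path_elt q = pmul p q.
Proof. exact: kqmul_elt. Qed.

Definition ideal (I : KQ -> Prop) : Prop :=
  [/\ I 0, forall x y, I x -> I y -> I (x + y)
    & forall a x, I x -> I (a * x) /\ I (x * a)].

Definition ideal_gen (E : KQ -> Prop) (x : KQ) : Prop :=
  forall J, ideal J -> (forall y, E y -> J y) -> J x.

Definition ideal_exp (I : KQ -> Prop) (m : nat) : KQ -> Prop :=
  ideal_gen (fun x => exists2 y : 'I_m -> KQ, forall i, I (y i) & x = \prod_i y i).

Definition arrow_ideal : KQ -> Prop :=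
  ideal_gen (fun x => exists a : arrow Q, x = path_elt (arrow_path a)).

Definition admissible (I : KQ -> Prop) : Prop :=
  [/\ ideal I, forall x, I x -> ideal_exp arrow_ideal 2 x
    & exists2 m, (2 <= m)%N & forall x, ideal_exp arrow_ideal m x -> I x].

Lemma mcoeff_trivM i (x y : KQ) :
  (x * y)@_(triv Q i) = x@_(triv Q i) * y@_(triv Q i).
Proof.
have E f (z : KQ) : (pext f z)@_(triv Q i) =
    \sum_(p <- msupp z) z@_p * (f p)@_(triv Q i).
  by rewrite pextE raddf_sum; apply: eq_bigr => p _; rewrite /= mcoeffZ.
have C (z : KQ) : \sum_(p <- msupp z) z@_p * (p == triv Q i)%:R = z@_(triv Q i).
  rewrite -[in RHS](pext_id z) E; apply: eq_bigr => p _.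
  by rewrite path_eltE.
rewrite pathalgM E -[in RHS](C x) mulr_suml.
apply: eq_bigr => p _; rewrite -mulrA; congr (_ * _).
rewrite E -(C y) mulr_sumr; apply: eq_bigr => q _.
rewrite mulrCA; congr (_ * _); rewrite -natrM mulnb -pcomp_eq_triv /pmul.
by case: pcomp => [r|] /=; rewrite ?mcoeff0 ?path_eltE.
Qed.

Lemma admissible_triv I (i : V) x : admissible I -> I x -> x@_(triv Q i) = 0.
Proof.
case=> _ le _ /le h; pose J (y : KQ) := y@_(triv Q i) = 0.
have idJ : ideal J.
  split=> [|y z|a y]; rewrite /J ?mcoeff0 //.
    by move=> hy hz; rewrite mcoeffD hy hz addr0.
  by move=> hy; rewrite !mcoeff_trivM hy mulr0 mul0r.
apply: (h J idJ) => y [z hz ->]; rewrite /J big_ord_recl mcoeff_trivM.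
have -> : (z ord0)@_(triv Q i) = 0; last by rewrite mul0r.
by apply: (hz ord0 J idJ) => _ [a ->];
  rewrite /J path_eltE; case: eqP => // /(congr1 (@parr V Q)).
Qed.

End PathAlgebra.

(* The quotient KQ / I is any falgType with a surjective algebra morphism from KQ
   with kernel I. It is an {rmorphism _} with a scalability field, since
   {lrmorphism _} needs a nontrivial source ring. *)
Record bqalg (K : fieldType) (V : finType) (Q : quiver V) := BQAlg {
  bq_sort :> falgType K;
  bq_ideal : pathalg K Q -> Prop;
  bq_proj : {rmorphism pathalg K Q -> bq_sort};
  bq_admissible : admissible bq_ideal;
  bq_scalable : scalable bq_proj;
  bq_surj : forall a, exists x, bq_proj x = a;
  bq_ker : forall x, bq_proj x = 0 <-> bq_ideal x
}.

Record fdmod (K : fieldType) (A : falgType K) := FDMod {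
  fd_sort :> vectType K;
  act : A -> fd_sort -> fd_sort;
  act_linl : forall x, linear (act^~ x);
  act_linr : forall a, linear (act a);
  act1 : forall x, act 1 x = x;
  actM : forall a b x, act (a * b) x = act a (act b x)
}.

Section Modules.
Variables (K : fieldType) (A : falgType K).
Implicit Types M N : fdmod A.

Definition mod_hom M N (f : 'Hom(M, N)) : Prop :=
  forall a x, f (act a x) = act a (f x).
Definition mod_mono M N (f : 'Hom(M, N)) : Prop := mod_hom f /\ lker f = 0%VS.
Definition mod_epi M N (f : 'Hom(M, N)) : Prop := mod_hom f /\ limg f = fullv.

Definition submod M (U : {vspace M}) : Prop :=
  forall a x, x \in U -> act a x \in U.
#[global] Arguments submod M U : clear implicits.

(* U / W is isomorphic to N, for submodules W <= U of M: a linear map which is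
   A-linear on U and maps U onto N with kernel W. Its values outside U are
   irrelevant. *)
Definition factor_iso M (W U : {vspace M}) N : Prop :=
  exists f : 'Hom(M, N),
    [/\ {in U, forall x, forall a, f (act a x) = act a (f x)},
        (f @: U)%VS = fullv & (U :&: lker f)%VS = W].
#[global] Arguments factor_iso M W U N : clear implicits.

Definition series M (l : nat) (F : nat -> {vspace M}) : Prop :=
  [/\ F 0%N = 0%VS, F l = fullv
    & forall k, (k < l)%N -> submod M (F k.+1) /\ (F k <= F k.+1)%VS].
#[global] Arguments series M l F : clear implicits.

Definition nfactors M l (F : nat -> {vspace M}) N : nat :=
  #|[set k : 'I_l | `[< factor_iso M (F k) (F k.+1) N >]]|.
#[global] Arguments nfactors M l F N : clear implicits.

Definition simple_factor M (W U : {vspace M}) : Prop :=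
  W <> U /\
  forall X : {vspace M}, submod M X -> (W <= X)%VS -> (X <= U)%VS -> X = W \/ X = U.
#[global] Arguments simple_factor M W U : clear implicits.

(* The multiplicities [M : N] and (M : D i) are relations between modules and
   naturals: some composition series (resp. filtration by members of D) has
   exactly m subquotients isomorphic to N (resp. D i). *)
Definition jh_mult M N (m : nat) : Prop :=
  exists l (F : nat -> {vspace M}), [/\ series M l F,
    forall k, (k < l)%N -> simple_factor M (F k) (F k.+1) & nfactors M l F N = m].

Definition filtration (T : Type) (D : T -> fdmod A) M l (F : nat -> {vspace M}) : Prop :=
  series M l F /\ forall k, (k < l)%N -> exists t, factor_iso M (F k) (F k.+1) (D t).
#[global] Arguments filtration T D M l F : clear implicits.
#[global] Arguments filtration {T} D M l F.

Definition good (T : Type) (D : T -> fdmod A) M : Prop :=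
  exists l F, filtration D M l F.

Definition filt_mult (T : Type) (D : T -> fdmod A) M (t : T) (m : nat) : Prop :=
  exists l F, filtration D M l F /\ nfactors M l F (D t) = m.

Definition is_socle M (U : {vspace M}) : Prop :=
  let simples_in (X : {vspace M}) :=
    forall W : {vspace M}, submod M W -> simple_factor M 0%VS W -> (W <= X)%VS in
  simples_in U /\ forall X, simples_in X -> (U <= X)%VS.
#[global] Arguments is_socle M U : clear implicits.

Definition is_radical M (U : {vspace M}) : Prop :=
  forall x, x \in U <->
    (forall W : {vspace M}, submod M W -> simple_factor M W fullv -> x \in W).
#[global] Arguments is_radical M U : clear implicits.

Definition soc_iso M N : Prop := exists2 U : {vspace M}, is_socle M U & factor_iso M 0%VS U N.
Definition top_iso M N : Prop := exists2 U : {vspace M}, is_radical M U & factor_iso M U fullv N.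

Section SubModule.
Variables (M : fdmod A) (U : {vspace M}) (sU : submod M U).

Definition sub_act (a : A) (x : subvs_of U) : subvs_of U := vsproj U (act a (vsval x)).

Lemma sub_actE a x : vsval (sub_act a x) = act a (vsval x).
Proof. by rewrite vsprojK // sU // subvsP. Qed.

Fact sub_act_linl x : linear (sub_act^~ x).
Proof.
move=> c a b; apply: subvs_inj; rewrite (linearP (@vsval _ _ U)) /= !sub_actE.
exact: act_linl.
Qed.
Fact sub_act_linr a : linear (sub_act a).
Proof.
move=> c x y; apply: subvs_inj; rewrite (linearP (@vsval _ _ U)) /= !sub_actE.
by rewrite (linearP (@vsval _ _ U)); exact: act_linr.
Qed.
Fact sub_act1 x : sub_act 1 x = x.
Proof. by apply: subvs_inj; rewrite sub_actE act1. Qed.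
Fact sub_actM a b x : sub_act (a * b) x = sub_act a (sub_act b x).
Proof. by apply: subvs_inj; rewrite !sub_actE actM. Qed.

Definition submodule : fdmod A :=
  FDMod sub_act_linl sub_act_linr sub_act1 sub_actM.
End SubModule.

Fact reg_linl (x : A) : linear ( *%R^~ x).
Proof. by move=> c a b; rewrite mulrDl scalerAl. Qed.
Fact reg_linr (a : A) : linear ( *%R a).
Proof. by move=> c x y; rewrite mulrDr scalerAr. Qed.

Definition regmod : fdmod A :=
  FDMod reg_linl reg_linr (@mul1r A) (fun a b x => esym (mulrA a b x)).

(* The K-dual of the right ideal U, with (a . f) x = f (x * a). *)
Section DualModule.
Variables (U : {vspace A}) (rU : forall a x, x \in U -> x * a \in U).

Definition dual_act (a : A) (f : 'Hom(subvs_of U, K^o)) : 'Hom(subvs_of U, K^o) :=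
  (f \o (linfun (vsproj U) \o (amulr a \o linfun vsval)))%VF.

Lemma dual_actE a f x : dual_act a f x = f (vsproj U (vsval x * a)).
Proof. by rewrite /dual_act !comp_lfunE !lfunE /=. Qed.

Fact dual_linl f : linear (dual_act^~ f).
Proof.
move=> c a b; apply/lfunP => x; rewrite add_lfunE scale_lfunE !dual_actE.
by rewrite mulrDr -scalerAr !linearP.
Qed.
Fact dual_linr a : linear (dual_act a).
Proof.
move=> c f g; apply/lfunP => x.
by rewrite add_lfunE scale_lfunE !dual_actE add_lfunE scale_lfunE.
Qed.
Fact dual_act1 f : dual_act 1 f = f.
Proof. by apply/lfunP => x; rewrite dual_actE mulr1 vsvalK. Qed.
Fact dual_actM a b f : dual_act (a * b) f = dual_act a (dual_act b f).
Proof.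
apply/lfunP => x; rewrite !dual_actE vsprojK ?mulrA //.
by rewrite rU ?subvsP.
Qed.

Definition dualmod : fdmod A := FDMod dual_linl dual_linr dual_act1 dual_actM.
End DualModule.

End Modules.

Section BoundQuiverAlgebra.
Variables (K : fieldType) (V : finType) (Q : quiver V) (A : bqalg K Q).

Definition pimg (p : qpath Q) : A := bq_proj A (path_elt K p).
Definition idem (i : V) : A := pimg (triv Q i).

Definition Aidem (j : V) : {vspace A} := (fullv * <[idem j]>)%VS.
Definition Aidem_at (j k : V) : {vspace A} := (<[idem k]> * Aidem j)%VS.

Fact Aidem_submod (j : V) : submod (regmod A) (Aidem j).
Proof.
move=> a x xP; have : a * x \in (fullv * Aidem j)%VS by rewrite memv_mul ?memvf.
by rewrite /Aidem prodvA; apply/subvP/prodvSl; rewrite subvf.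
Qed.

Definition Pmod (j : V) : fdmod A := submodule (@Aidem_submod j).

Definition idemA (j : V) : {vspace A} := (<[idem j]> * fullv)%VS.

Fact idemA_right j a x : x \in idemA j -> x * a \in idemA j.
Proof.
move=> xP; have : x * a \in (idemA j * fullv)%VS by rewrite memv_mul ?memvf.
by rewrite /idemA -prodvA; apply/subvP/prodvSr; rewrite subvf.
Qed.

Definition Imod (j : V) : fdmod A := dualmod (@idemA_right j).

(* S(i) is K, on which a class acts through the coefficient of e_i in any of
   its representatives in KQ. *)
Definition kq_lift (a : A) : pathalg K Q := sval (cid (bq_surj a)).
Definition chi (i : V) (a : A) : K := (kq_lift a)@_(triv Q i).

Lemma chiE i x : chi i (bq_proj A x) = x@_(triv Q i).
Proof.
rewrite /chi /kq_lift; case: cid => y /= e; apply/eqP.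
rewrite -subr_eq0 -mcoeffB; apply/eqP.
apply: admissible_triv (bq_admissible A) _.
by apply/bq_ker; rewrite rmorphB e subrr.
Qed.

Fact simple_linl i (x : K^o) : linear (fun a => chi i a * x : K^o).
Proof.
move=> c a b; have [[y <-] [z <-]] := (bq_surj a, bq_surj b).
by rewrite -bq_scalable -rmorphD !chiE mcoeffD mcoeffZ mulrDl -mulrA.
Qed.
Fact simple_linr i (a : A) : linear (fun x : K^o => chi i a * x : K^o).
Proof. by move=> c x y; rewrite mulrDr [c *: x]/(c * x) mulrCA. Qed.
Fact simple_act1 i (x : K^o) : chi i 1 * x = x.
Proof.
rewrite -(rmorph1 (bq_proj A)) chiE pathalg1 raddf_sum /=.
rewrite (bigD1 i) //= path_eltE eqxx big1 ?addr0 ?mul1r // => j ji.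
rewrite path_eltE; case: eqP => // /(congr1 (@psrc V Q)) e.
by rewrite (e : j = i) eqxx in ji.
Qed.
Fact simple_actM i (a b : A) (x : K^o) : chi i (a * b) * x = chi i a * (chi i b * x).
Proof.
have [[y <-] [z <-]] := (bq_surj a, bq_surj b).
by rewrite -rmorphM !chiE mcoeff_trivM mulrA.
Qed.

Definition Smod (i : V) : fdmod A :=
  FDMod (simple_linl i) (simple_linr i) (simple_act1 i) (@simple_actM i).

End BoundQuiverAlgebra.

Section QuasiHereditary.
Variables (K : fieldType) (d : Order.disp_t) (V : finPOrderType d).
Variables (Q : quiver V) (A : bqalg K Q).
Implicit Types i j k : V.
Local Notation S := (Smod A).
Local Notation P := (Pmod A).
Local Notation I := (Imod A).

Definition supp_below (M : fdmod A) i : Prop :=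
  forall j, ~~ (j <= i)%O -> jh_mult M (S j) 0.

(* D is, up to isomorphism, the largest factor module of P(i) (resp. submodule
   of I(i)) whose composition factors are all S(j) with j <= i. *)
Definition is_standard i (D : fdmod A) : Prop :=
  supp_below D i /\
  exists f : 'Hom(P i, D), mod_epi f /\
    forall (N : fdmod A) (g : 'Hom(P i, N)),
      mod_epi g -> supp_below N i -> (lker f <= lker g)%VS.

Definition is_costandard i (D : fdmod A) : Prop :=
  supp_below D i /\
  exists f : 'Hom(D, I i), mod_mono f /\
    forall (N : fdmod A) (g : 'Hom(N, I i)),
      mod_mono g -> supp_below N i -> (limg g <= limg f)%VS.

Definition quasi_hereditary (Delta : V -> fdmod A) : Prop :=
  (forall i, is_standard i (Delta i)) /\
  forall i j,
    [/\ jh_mult (Delta i) (S i) 1,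
        good Delta (P i),
        ~~ (i <= j)%O -> filt_mult Delta (P i) j 0
      & filt_mult Delta (P i) i 1].

Definition one_quasi_hereditary : Prop :=
  exists Delta nabla : V -> fdmod A,
  [/\ quasi_hereditary Delta,
      forall i, is_costandard i (nabla i)
    & exists bot top : V,
      [/\ forall i, (bot <= i)%O && (i <= top)%O,
          forall i j, (j <= i)%O ->
            jh_mult (Delta i) (S j) 1 /\ filt_mult Delta (P j) i 1,
          forall j, soc_iso (P j) (S bot) /\ top_iso (I j) (S bot)
        & forall i,
            (exists f : 'Hom(Delta i, Delta top), mod_mono f) /\
            (exists g : 'Hom(nabla top, nabla i), mod_epi g)]].

Definition increasing (p : qpath Q) : bool :=
  all (fun a => (src Q a < tgt Q a)%O) (parr p).
Definition decreasing (p : qpath Q) : bool :=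
  all (fun a => (tgt Q a < src Q a)%O) (parr p).

(* x is the image in A of a path of the form p(j, i, k); the product in KQ
   concatenates, its right factor being traversed first. *)
Definition is_pjik j i k (x : A) : Prop :=
  exists u v : qpath Q,
    [/\ [/\ psrc u = j, ptgt u = i & increasing u],
        [/\ psrc v = i, ptgt v = k & decreasing v]
      & x = bq_proj A (path_elt K v * path_elt K u)].

End QuasiHereditary.

(* Main.v *)
Require Import Defs.
From mathcomp Require Import all_boot all_order all_algebra all_field.
From HB Require Import structures.
From mathcomp Require Import boolp.
From mathcomp.multinomials Require Import monalg.

Set Implicit Arguments.
Unset Strict Implicit.
Unset Printing Implicit Defensive.

Import Order.TTheory GRing.Theory.
Local Open Scope ring_scope.

(* Write e_i for the idempotents, n for the largest vertex and J_i for the ideal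
   generated by the e_l with l not below i. A Delta-filtration of P(j) contains each
   Delta(i) with i >= j exactly once, since the multiplicities are determined by the
   dimensions of the weight spaces; as Delta(i) is generated in weight i and has a
   one-dimensional weight space for each k <= i, this gives dim e_k A e_j = #{i >= j, k}
   and e_k A e_j = sum_{i >= j, k} e_k A e_i A e_j. Hence it suffices to span.

   The spaces e_i A e_n and e_n A e_i are lines. By Delta(i) -> Delta(n), an element of
   A e_i that kills e_i A e_n lies in J_i; by nabla(n) ->> nabla(i), so does an element
   of e_i A killed by e_n A e_i. An arrow a: x -> y between comparable distinct vertices
   is not in J_x (y < x), respectively J_y (x < y): otherwise it would be a sum of
   products through vertices other than x and y, hence in the square of the radical.
   So decreasing paths act injectively on the lines e_i A e_n, increasing ones on the
   lines e_n A e_i, and therefore e_k A e_i A e_j is spanned by p(j,i,k) modulo the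
   spaces e_k A e_m A e_j with m > i. Descending induction on i concludes. *)

(** * Path length in KQ and the powers of the arrow ideal *)

Section PathLength.
Variables (K : fieldType) (V : finType) (Q : quiver V).
Local Notation KQ := (pathalg K Q).
Implicit Types (x y : KQ) (m : nat).

(** Support description of the m-th power of the arrow ideal: a condition on coefficients replaces
    sums of products of generators. *)
Definition long m x : Prop :=
  forall p : qpath Q, x@_p != 0 -> (m <= size (parr p))%N.

Lemma long0 m : long m 0.
Proof. by move=> p; rewrite mcoeff0 eqxx. Qed.

Lemma longD m x y : long m x -> long m y -> long m (x + y).
Proof.
move=> hx hy p; rewrite mcoeffD; have [e|/hx //] := eqVneq (x@_p) 0.
by rewrite e add0r => /hy.
Qed.

Lemma longZ m (c : K) x : long m x -> long m (c *: x).
Proof. by move=> hx p; rewrite mcoeffZ mulf_eq0 negb_or => /andP[_ /hx]. Qed.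

Lemma long_sum m (I : Type) (r : seq I) (P : pred I) (F : I -> KQ) :
  (forall i, P i -> long m (F i)) -> long m (\sum_(i <- r | P i) F i).
Proof. by move=> h; apply: big_ind => //; [exact: long0 | exact: longD]. Qed.

Lemma long_elt m (p : qpath Q) :
  (m <= size (parr p))%N -> long m (path_elt K p).
Proof. by move=> h q; rewrite path_eltE; have [<-|] := eqVneq p q; rewrite ?eqxx. Qed.

Lemma longM m n x y : long m x -> long n y -> long (m + n) (x * y).
Proof.
move=> hx hy; rewrite pathalgM pextE; apply: long_sum => p _.
have [->|/hx lp] := eqVneq (x@_p) 0; first by rewrite scale0r; exact: long0.
apply: longZ; rewrite pextE; apply: long_sum => q _.
have [->|/hy lq] := eqVneq (y@_q) 0; first by rewrite scale0r; exact: long0.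
apply: longZ; rewrite /pmul; case E: (Defs.pcomp p q) => [r|]; last exact: long0.
have [_ _ e] := pcomp_Some E.
by apply: long_elt; rewrite e size_cat addnC leq_add.
Qed.

Lemma long_all x : long 0 x. Proof. by []. Qed.

Lemma long_ideal m : ideal (long m).
Proof.
split=> [|x y|a x hx]; [exact: long0 | exact: longD |].
by split; [have := longM (@long_all a) hx
  | have := longM hx (@long_all a); rewrite addn0].
Qed.

Lemma long1P x : (forall i, x@_(triv Q i) = 0) -> long 1 x.
Proof.
move=> h p np; rewrite lt0n size_eq0; apply: contra_neq np => e.
by rewrite -(h (psrc p)); congr (_@__); apply: qpath_eq.
Qed.

Lemma arrow_ideal_long x : arrow_ideal x -> long 1 x.
Proof. by move=> /(_ _ (long_ideal 1)); apply=> _ [a ->]; exact: long_elt. Qed.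

(** Lengths add under composition, so [long m] is an ideal containing all products of [m] elements
    of the arrow ideal. *)
Lemma ideal_exp_long m x : ideal_exp (@arrow_ideal K V Q) m x -> long m x.
Proof.
move=> /(_ _ (long_ideal m)); apply=> _ [y hy ->].
have h i : long 1 (y i) by apply: arrow_ideal_long.
elim: m y {hy} h => [|m IH] y h; first by rewrite big_ord0.
rewrite big_ord_recl; apply: (@longM 1 m); first exact: h.
by apply: IH => i; exact: h.
Qed.

(** Peels off the arrow traversed last; it becomes the left factor because right factors are
    traversed first. *)
Lemma path_elt_rcons (p : qpath Q) s a : parr p = rcons s a ->
  exists q : qpath Q, [/\ parr q = s, psrc q = psrc p, ptgt q = src Q a &
    path_elt K p = path_elt K (arrow_path a) * path_elt K q].
Proof.
move=> e; have w : walk (psrc p) (rcons s a) by rewrite -e; exact: (valP p).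
move: w; rewrite -cats1 walk_cat => /andP[ws /andP[/eqP wa _]].
pose q : qpath Q := @QPath V Q (psrc p, s) ws.
exists q; split=> //; rewrite path_eltM /pmul.
have [//|r [-> h1 h2]] := @pcompP V Q (arrow_path a) q.
by congr path_elt; apply: qpath_eq => //; rewrite h2 e -cats1.
Qed.

Lemma path_elt_arrow_ideal (p : qpath Q) :
  (0 < size (parr p))%N -> arrow_ideal (path_elt K p).
Proof.
case/lastP E: (parr p) => [//|s a] _ J idJ hJ.
have [q [_ _ _ ->]] := path_elt_rcons E.
by have [_ _ h] := idJ; apply: (h _ _ _).2; apply: hJ; exists a.
Qed.

Lemma path_elt_prod m (p : qpath Q) : (m < size (parr p))%N ->
  exists2 y : 'I_m.+1 -> KQ, forall i, arrow_ideal (y i) & path_elt K p = \prod_i y i.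
Proof.
elim: m p => [|m IH] p hp.
  exists (fun=> path_elt K p) => [i|]; first exact: path_elt_arrow_ideal.
  by rewrite big_ord_recl big_ord0 mulr1.
case/lastP E: (parr p) hp => [//|s a]; rewrite size_rcons ltnS => hs.
have [q [eq _ _ ->]] := path_elt_rcons E.
have [|y hy ->] := IH q; first by rewrite eq.
(* The peeled arrow takes index 0 and the factors of the shorter path move up by one. *)
exists (fun i => if unlift ord0 i is Some j then y j else path_elt K (arrow_path a)).
  by move=> i; case: unliftP => [j _|_]; [exact: hy | exact: path_elt_arrow_ideal].
rewrite [RHS]big_ord_recl unlift_none; congr (_ * _).
by apply: eq_bigr => i _; rewrite liftK.
Qed.

(** An ideal is only assumed closed under multiplication by elements of KQ; the scalar acts as the
    element [c *: 1]. *)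
Lemma ideal_scale (J : KQ -> Prop) (c : K) x : ideal J -> J x -> J (c *: x).
Proof.
case=> _ _ h /(h (c *: (1 : KQ))) [+ _].
suff -> : (c *: (1 : KQ) : KQ) * x = c *: x by [].
by rewrite pathalgM linearZ /= -pathalgM mul1r.
Qed.

Lemma long_ideal_exp m x : long m.+1 x -> ideal_exp (@arrow_ideal K V Q) m.+1 x.
Proof.
move=> hx J idJ hJ; rewrite -(pext_id x) pextE big_seq.
have [J0 JD _] := idJ; apply: big_ind => // p.
rewrite -mcoeff_neq0 => /hx /path_elt_prod hp.
by apply: ideal_scale => //; apply: hJ.
Qed.

End PathLength.

(** * Idempotents and the radical filtration of A *)

Section Radical.
Variables (K : fieldType) (V : finType) (Q : quiver V) (A : bqalg K Q).
Local Notation e i := (idem A i).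
Local Notation chi := (@chi K V Q A).

Lemma idemM i j : e i * e j = if i == j then e i else 0.
Proof.
rewrite /idem /pimg -rmorphM path_eltM /pmul pcomp_trivl -[ptgt _]/j.
by have [->|_] := eqVneq i j; rewrite ?rmorph0.
Qed.

Lemma idemK i : e i * e i = e i. Proof. by rewrite idemM eqxx. Qed.

Lemma sum_idem : \sum_i e i = 1.
Proof. by rewrite -(rmorph1 (bq_proj A)) pathalg1 rmorph_sum. Qed.

Lemma chi_idem i j : chi j (e i) = (i == j)%:R.
Proof.
rewrite chiE path_eltE; congr (_%:R : K); congr nat_of_bool.
by apply/eqP/eqP => [/(congr1 (@psrc V Q)) //|->].
Qed.

(** This is the m-th power of the Jacobson radical of A, with [rad 0] all of A. *)
Definition rad m (a : A) : Prop := exists2 x, long m x & bq_proj A x = a.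

Lemma radM m n a b : rad m a -> rad n b -> rad (m + n) (a * b).
Proof.
by case=> x hx <- [y hy <-]; exists (x * y); [exact: longM | exact: rmorphM].
Qed.

Lemma rad_all a : rad 0 a.
Proof. by have [x <-] := bq_surj a; exists x. Qed.

Lemma radMr m a b : rad m a -> rad m (a * b).
Proof. by move=> /radM /(_ (rad_all b)); rewrite addn0. Qed.

Lemma rad0 m : rad m 0.
Proof. by exists 0; [exact: long0 | rewrite rmorph0]. Qed.

Lemma radD m a b : rad m a -> rad m b -> rad m (a + b).
Proof.
by case=> x hx <- [y hy <-]; exists (x + y); [exact: longD | exact: rmorphD].
Qed.

Lemma rad_sum m (I : Type) (r : seq I) (P : pred I) (F : I -> A) :
  (forall i, P i -> rad m (F i)) -> rad m (\sum_(i <- r | P i) F i).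
Proof. by move=> h; apply: big_ind => //; [exact: rad0 | exact: radD]. Qed.

Lemma radZ m (c : K) a : rad m a -> rad m (c *: a).
Proof.
by case=> x hx <-; exists (c *: x); [exact: longZ | exact: bq_scalable].
Qed.

Lemma rad1P a : (forall i, chi i a = 0) -> rad 1 a.
Proof.
have [x <-] := bq_surj a => h; exists x => //; apply: long1P => i.
by rewrite -(@chiE _ _ _ A) h.
Qed.

Lemma chiM i a b : chi i (a * b) = chi i a * chi i b.
Proof.
by have [[x <-] [y <-]] := (bq_surj a, bq_surj b); rewrite -rmorphM !chiE mcoeff_trivM.
Qed.

(** Each [chi k] is multiplicative and vanishes on [e i] or on [e j]. *)
Lemma rad_off i j a : i != j -> rad 1 (e i * a * e j).
Proof.
move=> ij; apply: rad1P => k; rewrite !chiM !chi_idem.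
have [ik|_] := eqVneq i k; last by rewrite !mul0r.
by rewrite -ik eq_sym (negbTE ij) mulr0.
Qed.

(** A is basic: modulo the radical it is spanned by the idempotents, with coordinates [chi i]. *)
Lemma rad_chi a : exists2 b, rad 1 b & a = \sum_i chi i a *: e i + b.
Proof.
exists (a - \sum_i chi i a *: e i); last by rewrite addrC subrK.
have [x <-] := bq_surj a; apply: rad1P => j.
under eq_bigr do rewrite /idem /pimg -bq_scalable.
rewrite -rmorph_sum -rmorphB /= !chiE mcoeffB raddf_sum (bigD1 j) //= big1 => [|i ij].
  by rewrite addr0 mcoeffZ path_eltE eqxx mulr1 chiE subrr.
rewrite mcoeffZ path_eltE; case: eqP => [/(congr1 (@psrc V Q)) ji|_].
  by rewrite (ji : i = j) eqxx in ij.
by rewrite mulr0.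
Qed.

Lemma rad_nilpotent : exists m, forall a, rad m a -> a = 0.
Proof.
have [_ _ [[//|m] _ h]] := bq_admissible A.
exists m.+1 => _ [x hx <-]; apply/bq_ker/h; exact: long_ideal_exp.
Qed.

(** Relations are supported on paths of length at least 2, so a representative of the arrow of that
    kind would force the arrow itself to have length at least 2. *)
Lemma arrow_notin_rad2 (a : arrow Q) : ~ rad 2 (pimg A (arrow_path a)).
Proof.
case=> x hx ex; have [_ h _] := bq_admissible A.
have /bq_ker/h/ideal_exp_long h2 : bq_proj A (path_elt K (arrow_path a) - x) = 0.
  by rewrite rmorphB ex subrr.
have : (path_elt K (arrow_path a) - x + x)@_(arrow_path a) != 0.
  by rewrite subrK path_eltE eqxx oner_neq0.
by move/(longD h2 hx).
Qed.

Lemma pimg_arrow (a : arrow Q) :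
  e (tgt Q a) * pimg A (arrow_path a) * e (src Q a) = pimg A (arrow_path a).
Proof.
rewrite /idem /pimg -!rmorphM path_eltM /pmul pcomp_trivl eqxx path_eltM /pmul.
by rewrite pcomp_trivr eqxx.
Qed.

End Radical.

(** * Linear maps and separating functionals *)

Lemma linear_hom (K : fieldType) (E E' : vectType K) (f : E -> E') :
  linear f -> exists g : 'Hom(E, E'), g =1 f.
Proof.
move=> lf.
pose fL : {linear E -> E'} := HB.pack f (GRing.isLinear.Build K E E' *:%R f lf).
by exists (linfun fL) => x; rewrite lfunE.
Qed.

Lemma separating_form (K : fieldType) (E : vectType K) (W : {vspace E}) y :
  y \notin W -> exists2 f : 'Hom(E, K^o), (W <= lker f)%VS & f y = 1.
Proof.
(* [g] kills exactly [W]; a coordinate that is nonzero at [g y], rescaled, gives the functional. *)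
move=> yW; pose g := (\1 - projv W)%VF; pose X := vbasis {:E}.
have gE x : g x = x - projv W x by rewrite add_lfunE opp_lfunE id_lfunE.
have gy : g y != 0.
  by apply: contra yW; rewrite gE subr_eq0 => /eqP->; exact: memv_proj.
have [i ci] : exists i, coord X i (g y) != 0.
  apply/existsP; apply: contra_neqT gy; rewrite negb_exists => /forallP h.
  rewrite (coord_vbasis (memvf (g y))) big1 // => i _.
  by move: (h i); rewrite negbK => /eqP->; rewrite scale0r.
have [|f hf] := @linear_hom K E K^o (fun x => (coord X i (g y))^-1 * coord X i (g x)).
  by move=> c u v; rewrite !linearP mulrDr mulrCA.
exists f; last by rewrite hf mulVf.
by apply/subvP => x xW; rewrite memv_ker hf (gE x) projv_id // subrr linear0 mulr0.
Qed.

(** * Cyclic submodules, subquotients and composition series *)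

Section ModuleAction.
Variables (K : fieldType) (A : falgType K).
Implicit Types (M N : fdmod A).

HB.instance Definition _ M a :=
  GRing.isLinear.Build K M M *:%R (@act K A M a) (act_linr a).

Definition actl M a : 'End(M) := linfun (@act K A M a).

Lemma actlE M a (x : M) : actl M a x = act a x. Proof. exact: lfunE. Qed.

Definition orb M (x : M) : 'Hom(A, M) := projT1 (cid (linear_hom (act_linl x))).

Lemma orbE M (x : M) a : orb x a = act a x.
Proof. by rewrite /orb; case: cid. Qed.

Lemma actDl M a b (x : M) : act (a + b) x = act a x + act b x.
Proof. by rewrite -!orbE linearD. Qed.

Lemma actZl M c a (x : M) : act (c *: a) x = c *: act a x.
Proof. by rewrite -!orbE linearZ. Qed.

Lemma act0l M (x : M) : act 0 x = 0.
Proof. by rewrite -!orbE linear0. Qed.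

Lemma actBr M a (x y : M) : act a (x - y) = act a x - act a y.
Proof. exact: linearB. Qed.

Lemma act_suml M (I : Type) (r : seq I) (P : pred I) (F : I -> A) (x : M) :
  act (\sum_(i <- r | P i) F i) x = \sum_(i <- r | P i) act (F i) x.
Proof. by rewrite -orbE linear_sum; apply: eq_bigr => i _; rewrite /= orbE. Qed.

Lemma submodD M (U W : {vspace M}) : submod M U -> submod M W -> submod M (U + W)%VS.
Proof.
move=> hU hW a _ /memv_addP[u uU [w wW ->]].
by rewrite linearD memv_add ?hU ?hW.
Qed.

Lemma submod_orb M (x : M) : submod M (limg (orb x)).
Proof.
by move=> a _ /memv_imgP[b _ ->]; rewrite orbE -actM -orbE memv_img ?memvf.
Qed.

Lemma mem_orb M (x : M) : x \in limg (orb x).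
Proof. by rewrite -{1}[x]act1 -orbE memv_img ?memvf. Qed.

Lemma submod0 M : submod M 0%VS.
Proof. by move=> a x; rewrite !memv0 => /eqP->; rewrite linear0. Qed.

(** Multiplication by an idempotent is an exact functor; the formula is rank-nullity for the
    isomorphism map restricted to [a U]. *)
Lemma factor_dim M (W U : {vspace M}) N a : a * a = a -> submod M U ->
  factor_iso M W U N ->
  \dim (actl M a @: U) = (\dim (actl M a @: W) + \dim (limg (actl N a)))%N.
Proof.
move=> aa sU [f [hf fU <-]]; rewrite -(limg_ker_dim f (actl M a @: U)).
congr (_ + _)%N; congr (\dim _).
  apply/eqP; rewrite eqEsubv; apply/andP; split; apply/subvP => x.
    case/memv_capP=> /memv_imgP[u uU ->]; rewrite actlE => k.
    by rewrite -{1}aa actM -actlE memv_img // memv_cap sU.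
  case/memv_imgP=> u /memv_capP[uU uk] ->; move: uk; rewrite memv_ker => /eqP fu.
  by rewrite memv_cap memv_img // memv_ker actlE hf // fu linear0 eqxx.
rewrite -fU; apply/eqP; rewrite eqEsubv; apply/andP; split; apply/subvP => x.
  by case/memv_imgP=> _ /memv_imgP[u uU ->] ->; rewrite actlE hf // -actlE !memv_img.
case/memv_imgP=> _ /memv_imgP[u uU ->] ->.
by rewrite actlE -hf // -actlE !memv_img.
Qed.

Lemma composition_series M (U : {vspace M}) : submod M U ->
  exists l (F : nat -> {vspace M}),
    [/\ F 0 = 0%VS, F l = U & forall k, (k < l)%N ->
      [/\ submod M (F k.+1), (F k <= F k.+1)%VS & simple_factor M (F k) (F k.+1)]].
Proof.
have [n le_n] := ubnP (\dim U); elim: n => // n IH in U le_n *.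
move=> sU; have [->|U0] := eqVneq U 0%VS; first by exists 0, (fun=> 0%VS).
(* A proper submodule of largest dimension is maximal, so the factor above it is simple. *)
pose P d := `[< exists X, [/\ submod M X, (X <= U)%VS, X <> U & \dim X = d] >].
have exP : exists d, P d.
  exists (\dim (0%VS : {vspace M})); apply/asboolP; exists 0%VS.
  by split=> //; [exact: submod0 | exact: sub0v | apply/eqP; rewrite eq_sym].
have bP d : P d -> (d <= \dim U)%N.
  by move=> /asboolP[X [_ h _ <-]]; exact: dimvS.
have [m /asboolP[X [sX XU neX dX]] mmax] := ex_maxnP exP bP.
have [||l [F [F0 Fl hF]]] := IH X => //.
  rewrite -ltnS; apply: leq_trans le_n; rewrite ltnS ltn_neqAle dimvS // andbT.
  by apply/eqP => e; apply: neX; apply/eqP; rewrite eqEdim XU e leqnn.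
exists l.+1, (fun k => if (k <= l)%N then F k else U); rewrite ltnn; split=> // k.
rewrite ltnS => kl; have [->|nkl] := eqVneq k l; last first.
  have kl' : (k < l)%N by rewrite ltn_neqAle nkl.
  by rewrite kl kl'; exact: hF.
rewrite leqnn ltnn Fl; split=> //; split=> // Y sY XY YU.
have [|/eqP nY] := eqVneq Y U; [by right | left].
apply/esym/eqP; rewrite eqEdim XY /= dX; apply: mmax.
by apply/asboolP; exists Y.
Qed.

End ModuleAction.

(** * Weight spaces e_j M and Jordan-Hölder multiplicities *)

Section Weights.
Variables (K : fieldType) (V : finType) (Q : quiver V) (A : bqalg K Q).
Local Notation e i := (idem A i).
Local Notation chi := (@chi K V Q A).
Implicit Types (M N : fdmod A).

Definition wt M j (U : {vspace M}) : {vspace M} := (actl M (e j) @: U)%VS.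
Definition wdim M j : nat := \dim (wt j (fullv : {vspace M})).

Lemma wtP M j (U : {vspace M}) x : submod M U ->
  reflect (x \in U /\ act (e j) x = x) (x \in wt j U).
Proof.
move=> sU; apply: (iffP memv_imgP) => [[u uU ->]|[xU <-]].
  by rewrite actlE -actM idemK; split; first exact: sU.
by exists x => //; rewrite actlE.
Qed.

Lemma wtfP M j x : reflect (act (e j) x = x) (x \in wt j (fullv : {vspace M})).
Proof.
by apply: (iffP (wtP j x _)) => // [a y _|[]|]; rewrite ?memvf //; split; rewrite ?memvf.
Qed.

Lemma wdim_simple i j : wdim (Smod A i) j = (i == j).
Proof.
have E (x : Smod A i) : act (e j) x = (j == i)%:R * (x : K) :> K.
  by rewrite -(@chi_idem _ _ _ A).
rewrite /wdim /wt eq_sym; have [ji|ji] := eqVneq j i.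
  suff -> : (actl (Smod A i) (e j) @: fullv)%VS = fullv.
    by rewrite dimvf.
  apply/eqP; rewrite eqEsubv subvf; apply/subvP => x _.
  suff -> : x = actl (Smod A i) (e j) x by rewrite memv_img ?memvf.
  by rewrite actlE; apply/esym; rewrite [LHS]E ji eqxx mul1r.
apply/eqP; rewrite dimv_eq0 -subv0; apply/subvP => _ /memv_imgP[x _ ->].
by rewrite memv0 actlE; apply/eqP; rewrite [LHS]E (negbTE ji) mul0r.
Qed.

(* If y lies in U and c lies in the largest possible power of the radical such that
   c y is outside W, then c y generates U modulo W and the radical maps it into W. *)
Lemma simple_factor_rad M (W U : {vspace M}) b x : submod M W -> submod M U ->
  (W <= U)%VS -> simple_factor M W U -> rad 1 b -> x \in U -> act b x \in W.
Proof.
move=> sW sU WU [_ simp] rb xU; have [n hn] := rad_nilpotent A.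
apply: contrapT => /negP bx.
pose P m := `[< exists c y, [/\ rad m c, y \in U & act c y \notin W] >].
have exP : exists m, P m by exists 1; apply/asboolP; exists b, x.
have bP m : P m -> (m <= n)%N.
  case/asboolP=> c [y [[z hz ec] _]]; rewrite leqNgt; apply: contra => nm.
  rewrite (_ : c = 0) ?act0l ?mem0v //; apply: hn; exists z => // p /hz.
  by apply: leq_trans; exact: ltnW.
have [m /asboolP[c [y [rc yU cy]]] mmax] := ex_maxnP exP bP.
have kill d : rad 1 d -> act d (act c y) \in W.
  move=> rd; apply: contrapT => /negP h; have /mmax : P m.+1.
    by apply/asboolP; exists (d * c), y; rewrite actM; split=> //; exact: (radM rd rc).
  by rewrite ltnn.
have eU : (W + limg (orb (act c y)))%VS = U.
  have [|||e|//] := simp (W + limg (orb (act c y)))%VS.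
  - by apply: submodD => //; exact: submod_orb.
  - exact: addvSl.
  - rewrite subv_add WU; apply/subvP => _ /memv_imgP[a _ ->].
    by rewrite orbE; apply: (sU); exact: sU.
  by case/negP: cy; rewrite -e; apply: (subvP (addvSr _ _)); exact: mem_orb.
case/negP: bx; move: xU; rewrite -eU => /memv_addP[w wW [_ /memv_imgP[a _ ->] ->]].
rewrite linearD /= memvD //; first exact: sW.
rewrite orbE -(actM b a).
by apply: kill; exact: radMr.
Qed.

(** The radical acts as zero on U/W, so [a] acts on the class of [y = e_j x] through [chi j a], and
    simplicity makes that class span U/W. *)
Lemma simple_factor_iso M (W U : {vspace M}) j x : submod M W -> submod M U ->
  (W <= U)%VS -> simple_factor M W U -> x \in U -> act (e j) x \notin W ->
  factor_iso M W U (Smod A j).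
Proof.
move=> sW sU WU simp xU nW; pose y := act (e j) x.
have kill b u : rad 1 b -> u \in U -> act b u \in W by exact: simple_factor_rad.
have yU : y \in U by exact: sU.
have ey i : act (e i) y = (j == i)%:R *: y.
  rewrite /y -actM idemM eq_sym; case: eqVneq => [->|_]; first by rewrite scale1r.
  by rewrite act0l scale0r.
have ay a : exists2 w, w \in W & act a y = chi j a *: y + w.
  have [b rb {1}->] := rad_chi a; exists (act b y); first exact: kill.
  rewrite actDl act_suml (bigD1 j) //= big1 ?addr0 => [|i ij].
    by rewrite actZl ey eqxx scale1r.
  by rewrite actZl ey eq_sym (negbTE ij) scale0r scaler0.
have eU : (W + <[y]>)%VS = U.
  case: simp => _ /(_ (W + <[y]>)%VS) [|||eW|//].
  - move=> a _ /memv_addP[w wW [_ /vlineP[c ->] ->]].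
    have [w' w'W aE] := ay a; rewrite linearD linearZ /= aE scalerDr scalerA addrCA.
    by rewrite addrC memv_add ?memvZ ?memv_line // memvD ?memvZ //; exact: sW.
  - exact: addvSl.
  - by rewrite subv_add WU -memvE.
  by case/negP: nW; rewrite -/y -eW; apply: (subvP (addvSr _ _)); exact: memv_line.
(* On [U], the functional [f] reads off the coefficient of [y] modulo [W]; this is the isomorphism
   onto S(j). *)
have [f fW fy] := separating_form nW; rewrite -/y in fy.
have f0 w : w \in W -> f w = 0 by move/(subvP fW); rewrite memv_ker => /eqP.
exists f; split.
- move=> u; rewrite -eU => /memv_addP[w wW [_ /vlineP[c ->] ->]] a.
  have [w' w'W aE] := ay a; rewrite !linearD !linearZ /= aE linearD linearZ /=.
  rewrite fy !f0 ?sW // !add0r addr0.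
  by rewrite mulr0 add0r.
- apply/eqP; rewrite eqEsubv subvf; apply/subvP => c _.
  suff -> : c = f (c *: y) by rewrite memv_img ?memvZ.
  by rewrite linearZ /= fy [RHS]mulr1.
apply/eqP; rewrite eqEsubv; apply/andP; split; apply/subvP => u; last first.
  by move=> uW; rewrite memv_cap (subvP WU) // memv_ker f0 ?eqxx.
rewrite -eU => /memv_capP[/memv_addP[w wW [_ /vlineP[c ->] ->]]].
rewrite memv_ker linearD linearZ /= fy f0 // add0r [_ *: _]mulr1 => /eqP->.
by rewrite scale0r addr0.
Qed.

(** If the factor is not S(j), every vector of weight [j] in [U] already lies in [W], since one
    outside [W] would produce an isomorphism. *)
Lemma simple_factor_wdim M (W U : {vspace M}) j : submod M W -> submod M U ->
  (W <= U)%VS -> simple_factor M W U ->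
  \dim (wt j U) = (\dim (wt j W) + `[< factor_iso M W U (Smod A j) >])%N.
Proof.
move=> sW sU WU simp; case: asboolP => [iso|niso].
  by rewrite /wt (factor_dim (idemK A j) sU iso) -/(wdim _ _) wdim_simple eqxx.
rewrite addn0; congr (\dim _); apply/eqP; rewrite eqEsubv (limgS _ WU) andbT.
apply/subvP => x /wtP-/(_ sU)[xU ex]; apply/wtP => //; split=> //.
rewrite -ex; apply: contrapT => /negP nW; apply: niso.
exact: simple_factor_iso nW.
Qed.

Lemma series_wdim M l (F : nat -> {vspace M}) j (c : nat -> nat) : series M l F ->
  (forall k, (k < l)%N -> \dim (wt j (F k.+1)) = (\dim (wt j (F k)) + c k)%N) ->
  wdim M j = (\sum_(k < l) c k)%N.
Proof.
case=> F0 Fl _ h; rewrite /wdim -Fl.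
elim: l {Fl} h => [|l IH] h; first by rewrite big_ord0 F0 /wt limg0 dimv0.
by rewrite big_ord_recr /= h // IH // => k kl; apply: h; exact: ltnW.
Qed.

Lemma series_submod M l (F : nat -> {vspace M}) k : series M l F -> (k <= l)%N ->
  submod M (F k).
Proof.
by case=> F0 _ h; case: k => [_|k /h[]//]; rewrite F0; exact: submod0.
Qed.

Lemma jh_series_wdim M l (F : nat -> {vspace M}) j : series M l F ->
  (forall k, (k < l)%N -> simple_factor M (F k) (F k.+1)) ->
  wdim M j = nfactors M l F (Smod A j).
Proof.
move=> sF simp; rewrite /nfactors -sum1dep_card big_mkcond /=.
rewrite (@series_wdim M l F j
  (fun k => `[< factor_iso M (F k) (F k.+1) (Smod A j) >] : nat)) //.
move=> k kl; have [_ _ /(_ _ kl)[sU WU]] := sF.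
by apply: simple_factor_wdim => //; [exact: series_submod (ltnW kl) | exact: simp].
Qed.

(** Counting along any composition series gives dim e_j M; hence the multiplicity, stated through
    some series, does not depend on it. *)
Lemma jh_multE M j m : jh_mult M (Smod A j) m <-> wdim M j = m.
Proof.
split=> [[l [F [sF simp <-]]]|<-]; first exact: jh_series_wdim.
have [//|l [F [F0 Fl hF]]] := @composition_series K A M fullv.
  by move=> a x _; exact: memvf.
have sF : series M l F by split=> // k /hF[].
have simp k : (k < l)%N -> simple_factor M (F k) (F k.+1) by move=> /hF[].
by exists l, F; split=> //; rewrite -jh_series_wdim.
Qed.

End Weights.

(** * Quotient modules and auxiliary linear algebra *)

Section Quotient.
Variables (K : fieldType) (A : falgType K) (M : fdmod A) (U : {vspace M}).
Hypothesis sU : submod M U.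

Lemma quotient_exists :
  exists (N : fdmod A) (q : 'Hom(M, N)), mod_epi q /\ lker q = U.
Proof.
pose C := (U^C)%VS.
(* The quotient is realised on a linear complement [C], with the action transported along the
   projection [r] of kernel [U]. *)
pose r : 'Hom(M, subvs_of C) := (linfun (vsproj C) \o (\1 - projv U))%VF.
have rE x : vsval (r x) = x - projv U x.
  by rewrite comp_lfunE lfunE /= vsprojK add_lfunE opp_lfunE id_lfunE ?memv_projC.
have r0 x : x \in U -> r x = 0.
  by move=> xU; apply: subvs_inj; rewrite rE projv_id // subrr linear0.
have rK z : r (vsval z) = z.
  apply: subvs_inj; rewrite rE.
  have: vsval z \in lker (projv U) by rewrite lker_proj subvsP.
  by rewrite memv_ker => /eqP->; rewrite subr0.
pose ac a (z : subvs_of C) := r (act a (vsval z)).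
have acr a x : ac a (r x) = r (act a x).
  rewrite /ac rE linearB /= linearB /= [X in _ - X]r0 ?subr0 //.
  by apply: sU; exact: memv_proj.
have linl z : linear (ac^~ z).
  by move=> c a b; rewrite /ac (act_linl (vsval z)) linearP.
have linr a : linear (ac a) by move=> c x y; rewrite /ac !linearP.
have ac1 z : ac 1 z = z by rewrite /ac act1 rK.
have acM a b z : ac (a * b) z = ac a (ac b z).
  by rewrite -[z in RHS]rK !acr -actM /ac.
pose N := FDMod linl linr ac1 acM.
exists N, r; split; first split.
- by move=> a x; rewrite -acr.
- apply/eqP; rewrite eqEsubv subvf; apply/subvP => z _.
  by rewrite -[z]rK memv_img ?memvf.
apply/eqP; rewrite eqEsubv; apply/andP; split; apply/subvP => x; last first.
  by move/r0; rewrite memv_ker => ->.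
rewrite memv_ker => /eqP rx0; have := rE x; rewrite rx0 linear0 => /esym/eqP.
by rewrite subr_eq0 => /eqP->; exact: memv_proj.
Qed.

End Quotient.

Lemma pred_vspace (K : fieldType) (E : vectType K) (P : E -> Prop) :
  P 0 -> (forall x y, P x -> P y -> P (x + y)) -> (forall (c : K) x, P x -> P (c *: x)) ->
  exists U : {vspace E}, forall x, x \in U <-> P x.
Proof.
move=> P0 PD PZ.
(* A subspace of largest dimension inside [P] is all of [P]: adding any vector of [P] cannot enlarge
   it. *)
pose B d := `[< exists2 U : {vspace E}, (forall x, x \in U -> P x) & \dim U = d >].
have exB : exists d, B d.
  exists (\dim (0%VS : {vspace E})); apply/asboolP; exists 0%VS => // x.
  by rewrite memv0 => /eqP->.
have bB d : B d -> (d <= \dim (fullv : {vspace E}))%N.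
  by case/asboolP=> U _ <-; exact: dimvS (subvf U).
have [m /asboolP[U UP dU] mmax] := ex_maxnP exB bB.
exists U => x; split; [exact: UP | move=> Px].
have eU : U = (U + <[x]>)%VS.
  apply/eqP; rewrite eqEdim addvSl dU; apply: mmax; apply/asboolP.
  exists (U + <[x]>)%VS => // y /memv_addP[u uU [_ /vlineP[c ->] ->]].
  by apply: PD; [exact: UP | exact: PZ].
by rewrite eU; apply: (subvP (addvSr _ _)); exact: memv_line.
Qed.

Lemma dim1_line (K : fieldType) (E : vectType K) (U : {vspace E}) v x :
  \dim U = 1%N -> v \in U -> v != 0 -> x \in U -> exists c, x = c *: v.
Proof.
move=> dU vU v0 xU; apply/vlineP; suff -> : <[v]>%VS = U by [].
by apply/eqP; rewrite eqEdim -memvE vU dU dim_vline v0.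
Qed.

(** * The spaces e_k A e_j and the projective modules *)

Section WeightSpaces.
Variables (K : fieldType) (V : finType) (Q : quiver V) (A : bqalg K Q).
Local Notation e i := (idem A i).
Implicit Types (x y : A).

Lemma AidemP j x : reflect (x * e j = x) (x \in Aidem A j).
Proof.
rewrite /Aidem -limg_amulr; apply: (iffP memv_imgP) => [[y _ ->]|<-].
  by rewrite lfunE /= -mulrA idemK.
by exists x; rewrite ?memvf // lfunE.
Qed.

Lemma idemAP j x : reflect (e j * x = x) (x \in idemA A j).
Proof.
apply: (iffP idP) => [|<-]; last by rewrite memv_mul ?memv_line ?memvf.
suff h : (idemA A j <= lker (amull (e j) - \1)%VF)%VS.
  by move/(subvP h)/eqlfunP; rewrite lfunE /= id_lfunE.
apply/prodvP => _ y /vlineP[c ->] _; apply/eqlfunP.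
by rewrite lfunE /= id_lfunE -scalerAl -scalerAr mulrA idemK.
Qed.

Lemma Aidem_atP j k x :
  reflect (e k * x = x /\ x * e j = x) (x \in Aidem_at A j k).
Proof.
apply: (iffP idP) => [|[kx /AidemP xj]]; last by rewrite -kx memv_mul ?memv_line.
rewrite /Aidem_at /Aidem prodvA => xP; split; last first.
  apply/AidemP; move: xP; apply/subvP; apply: prodvSl; exact: subvf.
by apply/idemAP; move: xP; rewrite -prodvA; apply/subvP; apply: prodvSr; exact: subvf.
Qed.

Lemma Aidem_atM i j k x y : x \in Aidem_at A i k -> y \in Aidem_at A j i ->
  x * y \in Aidem_at A j k.
Proof.
move=> /Aidem_atP[x1 x2] /Aidem_atP[y1 y2].
by apply/Aidem_atP; rewrite mulrA x1 -mulrA y2.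
Qed.

Lemma Aidem_at_sandwich j k x : e k * x * e j \in Aidem_at A j k.
Proof. by apply/Aidem_atP; rewrite !mulrA idemK -!mulrA idemK. Qed.

Definition gen j : Pmod A j := vsproj (Aidem A j) (e j).

Lemma val_gen j : vsval (gen j) = e j.
Proof. by rewrite vsprojK //; apply/AidemP; rewrite idemK. Qed.

Lemma val_act j a (x : Pmod A j) : vsval (act a x) = a * vsval x.
Proof. exact: (sub_actE (@Aidem_submod K V Q A j) a x). Qed.

Lemma act_gen j (x : Pmod A j) : act (vsval x) (gen j) = x.
Proof.
by apply: subvs_inj; rewrite val_act val_gen; apply/AidemP; exact: subvsP.
Qed.

Lemma wt_Pmod j k (x : Pmod A j) : (x \in wt k fullv) = (vsval x \in Aidem_at A j k).
Proof.
apply/wtfP/Aidem_atP => [<-|[h _]]; last by apply: subvs_inj; rewrite val_act.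
have /AidemP h := subvsP x.
by rewrite val_act mulrA idemK -mulrA h.
Qed.

Lemma wdim_Pmod j k : wdim (Pmod A j) k = \dim (Aidem_at A j k).
Proof.
pose g : 'Hom(Pmod A j, A) := linfun vsval.
have gE (x : Pmod A j) : g x = vsval x by exact: lfunE.
rewrite /wdim -(@limg_dim_eq _ _ _ g); last first.
  apply/eqP; rewrite -subv0; apply/subvP => x /memv_capP[_].
  by rewrite memv_ker gE memv0 => /eqP x0; apply/eqP/subvs_inj; rewrite x0 linear0.
congr (\dim _); apply/vspaceP => x; apply/memv_imgP/idP => [[y + ->]|xP].
  by rewrite gE wt_Pmod.
have xj : x \in Aidem A j by apply/AidemP; have /Aidem_atP[] := xP.
by exists (vsproj (Aidem A j) x); rewrite ?gE ?wt_Pmod vsprojK.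
Qed.

(** Both factors join distinct vertices and so lie in the radical. *)
Lemma rad2_through i j k x : i != j -> i != k ->
  x \in (Aidem_at A i k * Aidem_at A j i)%VS -> rad 2 x.
Proof.
move=> ij ik.
(* As a subspace [R], the square of the radical can be tested on products of two elements. *)
have [R RP] := pred_vspace (@rad0 _ _ _ A 2) (@radD _ _ _ A 2) (@radZ _ _ _ A 2).
suff /subvP h : (Aidem_at A i k * Aidem_at A j i <= R)%VS by move/h/RP.
apply/prodvP => a b /Aidem_atP[a1 a2] /Aidem_atP[b1 b2]; apply/RP.
apply: (@radM _ _ _ _ 1 1).
  by rewrite -a2 -a1; apply: rad_off; rewrite eq_sym.
by rewrite -b2 -b1; exact: rad_off.
Qed.

End WeightSpaces.

(** Möbius inversion: the system is unitriangular, and is solved by induction on the number of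
    elements above [k]. *)
Lemma up_sum_inj (d : Order.disp_t) (V : finPOrderType d) (n n' : V -> nat) :
  (forall k, \sum_(i | (k <= i)%O) n i = \sum_(i | (k <= i)%O) n' i)%N -> n =1 n'.
Proof.
move=> h k; have [m] := ubnP #|[pred i | (k < i)%O]|.
elim: m k => // m IH k le_m.
have split_sum (f : V -> nat) :
    (\sum_(i | (k <= i)%O) f i = f k + \sum_(i | (k < i)%O) f i)%N.
  rewrite (bigD1 k) //=; congr (_ + _)%N; apply: eq_bigl => i.
  by rewrite lt_def andbC.
have := h k; rewrite !split_sum.
suff -> : (\sum_(i | (k < i)%O) n i = \sum_(i | (k < i)%O) n' i)%N.
  by move/addIn.
apply: eq_bigr => i ki; apply: IH; rewrite -ltnS; apply: leq_trans le_m.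
rewrite ltnS; apply: proper_card; apply/properP; split.
  by apply/subsetP => j; rewrite !inE; exact: lt_trans.
by exists i; rewrite !inE ?ltxx.
Qed.

(** * Standard filtrations of P(j) *)

Section StandardFiltrations.
Variables (K : fieldType) (d : Order.disp_t) (V : finPOrderType d).
Variables (Q : quiver V) (A : bqalg K Q) (Delta : V -> fdmod A).
Hypothesis Delta_std : forall i, is_standard i (Delta i).
Hypothesis Delta_wdim : forall i k, wdim (Delta i) k = (k <= i)%O.
Hypothesis Delta_filt : forall j i, filt_mult Delta (Pmod A j) i (j <= i)%O.
Local Notation e i := (idem A i).

(** The weights of Delta(i) form the down-set of [i], which determines [i]. *)
Lemma factor_iso_Delta_inj (M : fdmod A) (W U : {vspace M}) i i' : submod M U ->
  factor_iso M W U (Delta i) -> factor_iso M W U (Delta i') -> i = i'.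
Proof.
move=> sU h h'; have E k : (k <= i)%O = (k <= i')%O.
  have := factor_dim (idemK A k) sU h; rewrite (factor_dim (idemK A k) sU h').
  rewrite -!/(wdim _ _) !Delta_wdim => /addnI.
  by case: (k <= i)%O; case: (k <= i')%O.
by apply: le_anti; rewrite -E lexx E lexx.
Qed.

Lemma filtration_wdim (M : fdmod A) l (F : nat -> {vspace M}) k :
  filtration Delta M l F ->
  wdim M k = (\sum_(i | (k <= i)%O) nfactors M l F (Delta i))%N.
Proof.
case=> sF hF.
(* [t m] labels the m-th factor; beyond [l] its value is a dummy. *)
have [t tP] : exists t : nat -> V, forall m, (m < l)%N ->
    factor_iso M (F m) (F m.+1) (Delta (t m)).
  suff /boolp.choice[t tP] : forall m, exists i, (m < l)%N ->
      factor_iso M (F m) (F m.+1) (Delta i) by exists t.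
  by move=> m; case: (boolP (m < l)%N) => [/hF[i hi]|_]; [exists i | exists k].
rewrite (@series_wdim _ _ _ _ M l F k (fun m => (k <= t m)%O : nat)) //; last first.
  move=> m ml; have [_ _ /(_ _ ml)[sU _]] := sF.
  by rewrite /wt (factor_dim (idemK A k) sU (tP m ml)) -/(wdim _ _) Delta_wdim.
have nE i : nfactors M l F (Delta i) = (\sum_(m < l) (t m == i))%N.
  rewrite /nfactors -sum1dep_card big_mkcond; apply: eq_bigr => m _.
  have [_ _ /(_ _ (ltn_ord m))[sU _]] := sF.
  case: asboolP => [h|h].
    by rewrite (factor_iso_Delta_inj sU (tP m (ltn_ord m)) h) eqxx.
  by case: eqP h => // <- []; exact: tP.
under eq_bigr do rewrite nE; rewrite exchange_big; apply: eq_bigr => m _ /=.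
have [h|h] := boolP (k <= t m)%O.
  by rewrite (bigD1 (t m)) //= eqxx big1 // => i /andP[_ /negbTE]; rewrite eq_sym => ->.
by rewrite big1 // => i ki; case: eqP ki h => // <- ->.
Qed.

(** The hypothesis provides a filtration for each [i] separately. Weight dimensions determine the
    multiplicities by inversion, so a single filtration serves every [i]. *)
Lemma Pmod_filtration j : exists l (F : nat -> {vspace Pmod A j}),
  filtration Delta (Pmod A j) l F /\
  forall i, nfactors (Pmod A j) l F (Delta i) = (j <= i)%O.
Proof.
have [l [F [fF _]]] := Delta_filt j j; exists l, F; split=> // i.
have [l' [F' [fF' <-]]] := Delta_filt j i.
apply: (@up_sum_inj d V (fun i => nfactors (Pmod A j) l F (Delta i))
                        (fun i => nfactors (Pmod A j) l' F' (Delta i))) => k.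
by rewrite -!filtration_wdim.
Qed.

Lemma dim_Aidem_at j k :
  \dim (Aidem_at A j k) = #|[pred i | (j <= i)%O && (k <= i)%O]|.
Proof.
have [l [F [fF nF]]] := Pmod_filtration j.
rewrite -wdim_Pmod (filtration_wdim k fF) -sum1_card.
under eq_bigr do rewrite nF.
rewrite [RHS](eq_bigl (fun i => (k <= i)%O && (j <= i)%O)) => [|i]; last first.
  by rewrite !inE andbC.
by rewrite [RHS]big_mkcondr; apply: eq_bigr => i _; case: (j <= i)%O.
Qed.

Lemma standard_generator i : exists2 g : Delta i, act (e i) g = g &
  forall z, exists a, z = act a g.
Proof.
have [_ [f [[hf fT] _]]] := Delta_std i; exists (f (gen A i)).
  by rewrite -hf; congr (f _); apply: subvs_inj; rewrite val_act val_gen idemK.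
move=> z; have : z \in limg f by rewrite fT memvf.
by case/memv_imgP=> x _ ->; exists (vsval x); rewrite -hf act_gen.
Qed.

Definition through j k : {vspace A} :=
  (\sum_(i | (j <= i)%O && (k <= i)%O) Aidem_at A i k * Aidem_at A j i)%VS.

(* A weight vector of P(j) is traced down the Delta-filtration: the subquotient
   Delta(i) is generated in weight i and only has weights k <= i. *)
Lemma Aidem_at_through j k : (Aidem_at A j k <= through j k)%VS.
Proof.
have [l [F [[sF fF] nF]]] := Pmod_filtration j.
have [F0 Fl sub] := sF.
suff h m (y : Pmod A j) : (m <= l)%N -> y \in F m -> act (e k) y = y ->
    vsval y \in through j k.
  apply/subvP => x xP; have /Aidem_atP[xk xj] := xP.
  have E : vsval (vsproj (Aidem A j) x : Pmod A j) = x by rewrite vsprojK //; apply/AidemP.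
  rewrite -E; apply: (h l) => //; first by rewrite Fl memvf.
  by apply: subvs_inj; rewrite val_act E.
elim: m y => [|m IH] y ml.
  by rewrite F0 memv0 => /eqP-> _; rewrite linear0 mem0v.
move=> yF ey; have [i fi] := fF m ml; have [sU _] := sub m ml.
have ji : (j <= i)%O.
  have : (0 < nfactors (Pmod A j) l F (Delta i))%N.
    by apply/card_gt0P; exists (Ordinal ml); rewrite inE; apply/asboolP.
  by rewrite nF lt0b.
case: (fi) => f [hf fU kerf]; have [g eg genD] := standard_generator i.
have [ki|ki] := boolP (k <= i)%O; last first.
  apply: IH => //; first exact: ltnW.
  rewrite -kerf memv_cap yF memv_ker -memv0.
  have /eqP := Delta_wdim i k; rewrite (negbTE ki) dimv_eq0 => /eqP <-.
  by apply/wtfP; rewrite -hf // ey.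
have [y0 y0F fy0] : exists2 y0, y0 \in F m.+1 & g = f y0.
  by apply/memv_imgP; rewrite fU memvf.
have [a ay] := genD (f y).
(* [y1] has weight [k], passes through the vertex [i] and agrees with [y] modulo [F m], so the
   induction hypothesis applies to [y - y1]. *)
pose y1 := act (e k * a * e i) y0.
have y1F : y1 \in F m.+1 by exact: sU.
have fy1 : f y1 = f y.
  by rewrite hf // -fy0 !actM eg -ay -hf // ey.
have hB : vsval (y - y1) \in through j k.
  apply: IH; first exact: ltnW.
    by rewrite -kerf memv_cap memvB // memv_ker linearB /= fy1 subrr.
  by rewrite actBr ey /y1 -actM !mulrA idemK.
have -> : vsval y = vsval (y - y1) + vsval y1.
  by transitivity (vsval (y - y1 + y1)); [rewrite subrK | exact: (linearD (@vsval _ _ _))].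
apply: memvD; first exact: hB.
rewrite /through; apply: (subvP (sumv_sup i _ (subvv _))); first by rewrite ji.
have hy0 : vsval y0 * e j = vsval y0 by apply/AidemP; exact: subvsP.
have -> : vsval y1 = e k * a * e i * (e i * vsval y0 * e j).
  by rewrite val_act -(mulrA (e i)) hy0 mulrA -(mulrA _ (e i) (e i)) idemK.
by rewrite memv_mul ?Aidem_at_sandwich.
Qed.

(** * The ideals J_i and their factorizations through larger vertices *)

Definition upper_ideal i : {vspace A} := (\sum_(l | ~~ (l <= i)%O) Aidem A l * fullv)%VS.

Lemma mem_upper_ideal i l a b : ~~ (l <= i)%O -> a * e l * b \in upper_ideal i.
Proof.
move=> li; apply: (subvP (sumv_sup l li (subvv _))).
by rewrite memv_mul ?memvf //; apply/AidemP; rewrite -mulrA idemK.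
Qed.

Lemma upper_ideal_hom (E : vectType K) (f : 'Hom(A, E)) (T : {vspace E}) i :
  (forall l a b, ~~ (l <= i)%O -> f (a * e l * b) \in T) ->
  forall x, x \in upper_ideal i -> f x \in T.
Proof.
move=> h x; rewrite memv_preim; apply/subvP/subv_sumP => l li.
apply/prodvP => a b /AidemP <- _; rewrite -memv_preim; exact: h.
Qed.

Lemma upper_idealM i a b x : x \in upper_ideal i -> a * x * b \in upper_ideal i.
Proof.
move=> xJ; have fE y : (amulr b \o amull a)%VF y = a * y * b.
  by rewrite comp_lfunE !lfunE.
rewrite -fE; apply: upper_ideal_hom xJ => l u v li.
by rewrite fE !mulrA -(mulrA _ v) mem_upper_ideal.
Qed.

(** For a generator through [l], the part in e_l A e_i factors through vertices [m] above both [i]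
    and [l]; [m = i] would give [l <= i], so [m] is strictly larger. *)
Lemma upper_ideal_split_src i k x : x \in upper_ideal i -> x \in Aidem_at A i k ->
  x \in (\sum_(m | (i < m)%O) Aidem_at A m k * Aidem_at A i m)%VS.
Proof.
move=> xJ /Aidem_atP[xk xi].
have fE y : (amulr (e i) \o amull (e k))%VF y = e k * y * e i.
  by rewrite comp_lfunE !lfunE.
rewrite -xi -xk -fE; apply: upper_ideal_hom xJ => l a b li.
have -> : (amulr (e i) \o amull (e k))%VF (a * e l * b) = e k * a * e l * (e l * b * e i).
  by rewrite fE !mulrA -(mulrA _ (e l) (e l)) idemK.
have := subvP (Aidem_at_through i l) _ (Aidem_at_sandwich i l b).
case/memv_sumP=> y hy ->; rewrite mulr_sumr; apply: memv_suml => m /andP[im lm].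
have {}im : (i < m)%O.
  by rewrite lt_neqAle im andbT; apply: contraNneq li => ->.
apply: (subvP (sumv_sup m im (subvv _))).
move: (hy m); rewrite (ltW im) lm => /(_ isT).
suff /subvP h : (Aidem_at A m l * Aidem_at A i m <=
   amull (e k * a * e l) @^-1: (Aidem_at A m k * Aidem_at A i m))%VS.
  by move/h; rewrite -memv_preim lfunE.
apply/prodvP => u v hu hv; rewrite -memv_preim lfunE /= mulrA memv_mul //.
by apply: Aidem_atM hu; exact: Aidem_at_sandwich.
Qed.

(** Mirror image: here the part in e_i A e_l is factored. *)
Lemma upper_ideal_split_tgt i j x : x \in upper_ideal i -> x \in Aidem_at A j i ->
  x \in (\sum_(m | (i < m)%O) Aidem_at A m i * Aidem_at A j m)%VS.
Proof.
move=> xJ /Aidem_atP[xi xj].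
have fE y : (amulr (e j) \o amull (e i))%VF y = e i * y * e j.
  by rewrite comp_lfunE !lfunE.
rewrite -xj -xi -fE; apply: upper_ideal_hom xJ => l a b li.
have -> : (amulr (e j) \o amull (e i))%VF (a * e l * b) = e i * a * e l * (e l * b * e j).
  by rewrite fE !mulrA -(mulrA _ (e l) (e l)) idemK.
have := subvP (Aidem_at_through l i) _ (Aidem_at_sandwich l i a).
case/memv_sumP=> y hy ->; rewrite mulr_suml; apply: memv_suml => m /andP[lm im].
have {}im : (i < m)%O.
  by rewrite lt_neqAle im andbT; apply: contraNneq li => ->.
apply: (subvP (sumv_sup m im (subvv _))).
move: (hy m); rewrite lm (ltW im) => /(_ isT).
suff /subvP h : (Aidem_at A m i * Aidem_at A l m <=
   amulr (e l * b * e j) @^-1: (Aidem_at A m i * Aidem_at A j m))%VS.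
  by move/h; rewrite -memv_preim lfunE.
apply/prodvP => u v hu hv; rewrite -memv_preim lfunE /= -(mulrA u v) memv_mul //.
by apply: Aidem_atM hv _; exact: Aidem_at_sandwich.
Qed.

(** * The lines e_i A e_n and e_n A e_i and their annihilators *)

Variables (nabla : V -> fdmod A) (top : V).
Hypothesis nabla_costd : forall i, is_costandard i (nabla i).
Hypothesis le_top : forall i, (i <= top)%O.
Hypothesis Delta_embed :
  forall i, exists f : 'Hom(Delta i, Delta top), mod_mono f.
Hypothesis nabla_cover :
  forall i, exists f : 'Hom(nabla top, nabla i), mod_epi f.

Lemma dim_from_top i : \dim (Aidem_at A top i) = 1%N.
Proof.
rewrite dim_Aidem_at -(card1 top); apply: eq_card => m; rewrite !inE.
by apply/andP/eqP => [[tm _]|->]; [apply: le_anti; rewrite le_top | rewrite lexx le_top].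
Qed.

Lemma dim_to_top i : \dim (Aidem_at A i top) = 1%N.
Proof.
rewrite dim_Aidem_at -(card1 top); apply: eq_card => m; rewrite !inE.
by apply/andP/eqP => [[_ tm]|->]; [apply: le_anti; rewrite le_top | rewrite lexx le_top].
Qed.

Lemma supp_below_act i (N : fdmod A) :
  (forall l (x : N), ~~ (l <= i)%O -> act (e l) x = 0) -> supp_below N i.
Proof.
move=> h l li; apply/jh_multE; apply/eqP; rewrite dimv_eq0 -subv0.
apply/subvP => _ /memv_imgP[x _ ->]; by rewrite memv0 actlE h.
Qed.

(* The generator of Delta(i) embeds in Delta(n), a factor of P(n), as a multiple of
   v, so x kills the generator of Delta(i). *)
Lemma annihilates_top_src i x v : x * e i = x ->
  v \in Aidem_at A top i -> v != 0 -> x * v = 0 -> x \in upper_ideal i.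
Proof.
move=> xi vP v0 xv.
have [_ [f [[hf fT] fmax]]] := Delta_std i.
have [_ [fn [[hfn fnT] _]]] := Delta_std top.
have [g [hg gker]] := Delta_embed i.
(* [U] is J_i e_i. Since P(i)/U has only weights below [i], the maximality of Delta(i) puts the
   kernel of [f] inside [U]. *)
pose U : {vspace Pmod A i} := (linfun (vsval : Pmod A i -> A) @^-1: upper_ideal i)%VS.
have UP (z : Pmod A i) : (z \in U) = (vsval z \in upper_ideal i).
  by rewrite -memv_preim lfunE.
have sU : submod (Pmod A i) U.
  by move=> a z; rewrite !UP val_act => /(upper_idealM a 1); rewrite mulr1.
have [N [q [[hq qT] kerq]]] := quotient_exists sU.
have kerf : (lker f <= U)%VS.
  rewrite -kerq; apply: fmax => //; apply: supp_below_act => l y li.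
  have : y \in limg q by rewrite qT memvf.
  case/memv_imgP=> z _ ->; rewrite -hq; apply/eqP; rewrite -memv_ker kerq UP val_act.
  by rewrite -[e l]mul1r; apply: mem_upper_ideal.
suff : act x (gen A i) \in U by rewrite UP val_act val_gen xi.
apply: (subvP kerf); rewrite memv_ker; apply/eqP.
have gi : injective g by apply/lker0P; rewrite gker.
apply: gi; rewrite linear0 hf hg.
have : g (f (gen A i)) \in limg fn by rewrite fnT memvf.
case/memv_imgP=> z _ ez.
have ei : act (e i) (g (f (gen A i))) = g (f (gen A i)).
  by rewrite -hg -hf; congr (g (f _)); apply: subvs_inj; rewrite val_act val_gen idemK.
rewrite -ei ez -!hfn.
have [c zc] : exists c, vsval (act (e i) z) = c *: v.
  apply: dim1_line (dim_from_top i) vP v0 _.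
  have /AidemP <- := subvsP (act (e i) z).
  by rewrite val_act Aidem_at_sandwich.
suff -> : act x (act (e i) z) = 0 by rewrite linear0.
by apply: subvs_inj; rewrite val_act zc -scalerAr xv scaler0 linear0.
Qed.

Lemma val_Imod_act i a (phi : Imod A i) (z : subvs_of (idemA A i)) :
  (act a phi : 'Hom(subvs_of (idemA A i), K^o)) z =
  (phi : 'Hom(subvs_of (idemA A i), K^o)) (vsproj (idemA A i) (vsval z * a)).
Proof. exact: dual_actE. Qed.

(* nabla(i) contains every functional on e_i A vanishing on the upper ideal, and each
   of them lifts to nabla(n), a submodule of the dual of e_n A, where y acts as zero. *)
Lemma annihilates_top_tgt i y w : e i * y = y ->
  w \in Aidem_at A i top -> w != 0 -> w * y = 0 -> y \in upper_ideal i.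
Proof.
move=> yi wP w0 wy; apply: contrapT => /negP ny.
have [_ [f [[hf fker] fmax]]] := nabla_costd i.
have [_ [fn [[hfn fnker] _]]] := nabla_costd top.
have [g [hg gT]] := nabla_cover i.
set B := idemA A i; set B' := idemA A top.
have yB : y \in B by apply/idemAP.
pose T : {vspace subvs_of B} := (linfun vsval @^-1: upper_ideal i)%VS.
have TP (z : subvs_of B) : (z \in T) = (vsval z \in upper_ideal i).
  by rewrite -memv_preim lfunE.
have nyT : vsproj B y \notin T by rewrite TP vsprojK.
have [psi psiT psiy] := separating_form nyT.
(* The functionals vanishing on [T] form the kernel of [r], precomposition with the projection onto
   [T]; it is a submodule of I(i) with weights below [i]. *)
have [r rE] : exists r : 'End(Imod A i), forall phi : 'Hom(subvs_of B, K^o),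
    r phi = (phi \o projv T)%VF.
  apply: (@linear_hom K (Imod A i) (Imod A i)
    (fun phi : 'Hom(subvs_of B, K^o) => (phi \o projv T)%VF)).
  by move=> c p1 p2; rewrite comp_lfunDl comp_lfunZl.
have SP (phi : Imod A i) :
    reflect (forall z, z \in T -> (phi : 'Hom(subvs_of B, K^o)) z = 0)
    (phi \in lker r).
  rewrite memv_ker rE; apply: (iffP eqP) => [h z zT|h].
    by have /lfunP/(_ z) := h; rewrite comp_lfunE projv_id // zero_lfunE.
  by apply/lfunP => z; rewrite comp_lfunE zero_lfunE h ?memv_proj.
have proj_mul (z : subvs_of B) a : vsval (vsproj B (vsval z * a)) = vsval z * a.
  by rewrite vsprojK //; apply: idemA_right; exact: subvsP.
have sS : submod (Imod A i) (lker r).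
  move=> a phi /SP h; apply/SP => z; rewrite val_Imod_act TP => zJ; apply: h.
  by rewrite TP proj_mul -[vsval z]mul1r upper_idealM.
have vact a (z : submodule sS) : vsval (act a z) = act a (vsval z).
  exact: (sub_actE sS).
have mono : mod_mono (linfun (vsval : submodule sS -> Imod A i)).
  split=> [a z|]; first by rewrite !lfunE; exact: vact.
  apply/eqP/lker0P => z1 z2; rewrite !lfunE; exact: subvs_inj.
have supp : supp_below (submodule sS) i.
  apply: supp_below_act => l z li; apply: subvs_inj; rewrite vact linear0.
  apply/lfunP => u; rewrite val_Imod_act zero_lfunE; have /SP := subvsP z; apply.
  by rewrite TP proj_mul -[_ * e l]mulr1 mem_upper_ideal.
have psiS : psi \in lker r.
  by apply/SP => z /(subvP psiT); rewrite memv_ker => /eqP.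
have : psi \in limg f.
  apply: (subvP (fmax _ _ mono supp)).
  have -> : psi = linfun (vsval : submodule sS -> Imod A i) (vsproj (lker r) psi).
    by rewrite lfunE /= vsprojK.
  by rewrite memv_img ?memvf.
case/memv_imgP=> delta _ psiE.
have : delta \in limg g by rewrite gT memvf.
case/memv_imgP=> eps _ deltaE.
(* The value of [y eps] at [z] is that of [eps] at [z y], and [z e_i] is a multiple of [w], which
   satisfies [w * y = 0]. *)
have yeps : act y eps = 0.
  have fni : injective fn by apply/lker0P; rewrite fnker.
  apply: fni; rewrite linear0 hfn; apply/lfunP => z; rewrite val_Imod_act zero_lfunE.
  have [c zc] : exists c, vsval z * e i = c *: w.
    apply: dim1_line (dim_to_top i) wP w0 _.
    by have /idemAP <- := subvsP z; rewrite Aidem_at_sandwich.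
  by rewrite -yi mulrA zc -scalerAl wy scaler0 !linear0.
have y0 : act y (psi : Imod A i) = 0 by rewrite psiE deltaE -hf -hg yeps !linear0.
have eB : e i \in B by apply/idemAP; rewrite idemK.
(* At [e_i] the functional [y psi] takes the value psi(y) = 1, although it is zero. *)
have := val_Imod_act y psi (vsproj B (e i)).
rewrite y0 vsprojK // yi psiy zero_lfunE => /esym/eqP.
by rewrite oner_eq0.
Qed.

(** * Monotone paths acting on the lines *)

Lemma arrow_weight (a : arrow Q) :
  pimg A (arrow_path a) \in Aidem_at A (src Q a) (tgt Q a).
Proof. by rewrite -pimg_arrow Aidem_at_sandwich. Qed.

(** Otherwise the arrow factors through vertices above its source, which differ from both ends, and
    so lies in the square of the radical. *)
Lemma decreasing_arrow (a : arrow Q) v : (tgt Q a < src Q a)%O ->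
  v \in Aidem_at A top (src Q a) -> v != 0 -> pimg A (arrow_path a) * v != 0.
Proof.
move=> dec vP v0; apply/eqP => av; apply: (@arrow_notin_rad2 _ _ _ A a).
have aP := arrow_weight a; have /Aidem_atP[_ ai] := aP.
have aJ := annihilates_top_src ai vP v0 av.
have := upper_ideal_split_src aJ aP => /memv_sumP[y hy ->].
apply: rad_sum => m lt_m; apply: rad2_through (hy m lt_m).
  by rewrite gt_eqF.
by rewrite gt_eqF // (lt_trans dec).
Qed.

Lemma increasing_arrow (a : arrow Q) w : (src Q a < tgt Q a)%O ->
  w \in Aidem_at A (tgt Q a) top -> w != 0 -> w * pimg A (arrow_path a) != 0.
Proof.
move=> inc wP w0; apply/eqP => wa; apply: (@arrow_notin_rad2 _ _ _ A a).
have aP := arrow_weight a; have /Aidem_atP[ai _] := aP.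
have aJ := annihilates_top_tgt ai wP w0 wa.
have := upper_ideal_split_tgt aJ aP => /memv_sumP[y hy ->].
apply: rad_sum => m lt_m; apply: rad2_through (hy m lt_m).
  by rewrite gt_eqF // (lt_trans inc).
by rewrite gt_eqF.
Qed.

Lemma parr_nil (p : qpath Q) : parr p = [::] -> p = triv Q (psrc p).
Proof. by move=> h; apply: qpath_eq. Qed.

Lemma pimg_weight (p : qpath Q) : pimg A p \in Aidem_at A (psrc p) (ptgt p).
Proof.
apply/Aidem_atP; rewrite /idem /pimg -!rmorphM !path_eltM /pmul.
by rewrite pcomp_trivl pcomp_trivr !eqxx.
Qed.

Lemma decreasing_path (p : qpath Q) v : decreasing p ->
  v \in Aidem_at A top (psrc p) -> v != 0 -> pimg A p * v != 0.
Proof.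
have [n] := ubnP (size (parr p)); elim: n p v => // n IH p v.
case/lastP E: (parr p) => [|s a] le_n dec vP v0.
  by rewrite (parr_nil E); have /Aidem_atP[-> _] := vP.
have [q [qs qsrc qtgt pE]] := path_elt_rcons K E.
move: dec le_n; rewrite /decreasing E all_rcons size_rcons ltnS -qs
  => /andP[deca decq] le_n.
rewrite -qsrc in vP.
rewrite /pimg pE rmorphM -mulrA; apply: decreasing_arrow => //; last exact: IH.
by rewrite -qtgt; apply: Aidem_atM vP; exact: pimg_weight.
Qed.

(** The last arrow stands next to [w]: it carries [w] to a nonzero vector of the next line, to which
    induction on the length applies. *)
Lemma increasing_path (p : qpath Q) w : increasing p ->
  w \in Aidem_at A (ptgt p) top -> w != 0 -> w * pimg A p != 0.
Proof.
have [n] := ubnP (size (parr p)); elim: n p w => // n IH p w.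
case/lastP E: (parr p) => [|s a] le_n inc wP w0.
  have pE := parr_nil E; rewrite pE; have /Aidem_atP[_] := wP.
  by rewrite {1}pE => ->.
have [q [qs qsrc qtgt pE]] := path_elt_rcons K E.
move: inc le_n; rewrite /increasing E all_rcons size_rcons ltnS -qs
  => /andP[inca incq] le_n.
have ta : ptgt p = tgt Q a by rewrite /ptgt E map_rcons last_rcons.
rewrite ta in wP.
rewrite /pimg pE rmorphM mulrA; apply: IH => //; last exact: increasing_arrow.
by rewrite qtgt; apply: Aidem_atM wP _; exact: arrow_weight.
Qed.

(** * Spanning e_k A e_j by the elements p(j,i,k) *)

Lemma through_pjik j k (p : V -> A) :
  (forall i, (j <= i)%O -> (k <= i)%O -> is_pjik j i k (p i)) ->
  forall i, (j <= i)%O -> (k <= i)%O ->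
  (Aidem_at A i k * Aidem_at A j i <=
    <<[seq p i | i in [pred i : V | (j <= i)%O && (k <= i)%O]]>>)%VS.
Proof.
move=> hp i; set W := span _.
(* Descending induction in the order, by the number of vertices above [i]; [W] is the same for all
   [i]. *)
have [n] := ubnP #|[pred m | (i < m)%O]|; elim: n i => // n IH i le_n ji ki.
have IHm m x : (i < m)%O -> x \in (Aidem_at A m k * Aidem_at A j m)%VS -> x \in W.
  move=> im; apply/subvP/IH; try exact: le_trans (ltW im).
  rewrite -ltnS; apply: leq_trans le_n; rewrite ltnS.
  apply: proper_card; apply/properP; split.
    by apply/subsetP => l; rewrite !inE; exact: lt_trans.
  by exists m; rewrite !inE ?ltxx.
have [u [v [[us ut uinc] [vs vt vdec] pE]]] := hp i ji ki.
have pW : p i \in W.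
  by apply: memv_span; apply: image_f; rewrite inE ji.
have {pE} pE : p i = pimg A v * pimg A u by rewrite pE rmorphM.
have uP : pimg A u \in Aidem_at A j i by rewrite -us -ut pimg_weight.
have vP : pimg A v \in Aidem_at A i k by rewrite -vs -vt pimg_weight.
have nz (U : {vspace A}) : \dim U = 1%N -> exists2 x, x \in U & x != 0.
  move=> dU; exists (vpick U); first exact: memv_pick.
  by rewrite vpick0 -dimv_eq0 dU.
have [t tP t0] := nz _ (dim_from_top i).
have [w wP w0] := nz _ (dim_to_top i).
have vt0 : pimg A v * t != 0 by apply: decreasing_path => //; rewrite vs.
have wu0 : w * pimg A u != 0 by apply: increasing_path => //; rewrite ut.
apply/prodvP => x y xP yP.
have [c xc] : exists c, x * t = c *: (pimg A v * t).
  by apply: dim1_line (dim_from_top k) _ vt0 _; exact: Aidem_atM tP.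
have [c' yc] : exists c', w * y = c' *: (w * pimg A u).
  by apply: dim1_line (dim_to_top j) _ wu0 _; exact: Aidem_atM wP _.
(* By the choice of [c] and [c'], [x' * t = 0] and [w * y' = 0], so both differences lie in J_i. *)
set x' := x - c *: pimg A v; set y' := y - c' *: pimg A u.
have x'P : x' \in Aidem_at A i k by rewrite memvB ?memvZ.
have y'P : y' \in Aidem_at A j i by rewrite memvB ?memvZ.
have x'J : x' \in upper_ideal i.
  have /Aidem_atP[_ x'i] := x'P; apply: annihilates_top_src x'i tP t0 _.
  by rewrite mulrBl xc -scalerAl subrr.
have y'J : y' \in upper_ideal i.
  have /Aidem_atP[y'i _] := y'P; apply: annihilates_top_tgt y'i wP w0 _.
  by rewrite mulrBr yc -scalerAr subrr.
(* The last two terms contain a factor from J_i and hence pass through vertices above [i]. *)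
have xy : x * y = (c * c') *: p i + c *: (pimg A v * y') + x' * y.
  rewrite pE /x' /y' mulrBr mulrBl scalerBr -scalerAr -scalerAl scalerA.
  by rewrite [X in X + _]addrC subrK addrC subrK.
rewrite xy; apply: memvD; first apply: memvD; first exact: memvZ.
  apply: memvZ; case/memv_sumP: (upper_ideal_split_tgt y'J y'P) => z hz ->.
  rewrite mulr_sumr; apply: memv_suml => m im; apply: (IHm m) => //.
  have := memv_mul vP (hz m im); rewrite prodvA; apply/subvP/prodvSl/prodvP => a b aP bP.
  exact: Aidem_atM bP.
case/memv_sumP: (upper_ideal_split_src x'J x'P) => z hz ->.
rewrite mulr_suml; apply: memv_suml => m im; apply: (IHm m) => //.
have := memv_mul (hz m im) yP; rewrite -prodvA; apply/subvP/prodvSr/prodvP => a b aP bP.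
exact: Aidem_atM bP.
Qed.

Lemma span_pjik j k (p : V -> A) :
  (forall i, (j <= i)%O -> (k <= i)%O -> is_pjik j i k (p i)) ->
  (Aidem_at A j k <= <<[seq p i | i in [pred i : V | (j <= i)%O && (k <= i)%O]]>>)%VS.
Proof.
move=> hp; apply: subv_trans (Aidem_at_through j k) _.
by apply/subv_sumP => i /andP[ji ki]; exact: through_pjik.
Qed.

End StandardFiltrations.

(** * Decomposition of P(j) and A into the spaces e_k A e_j *)

Section DirectSums.
Variables (K : fieldType) (V : finType) (Q : quiver V) (A : bqalg K Q).

Lemma Aidem_sum j : Aidem A j = (\sum_k Aidem_at A j k)%VS.
Proof.
apply/eqP; rewrite eqEsubv; apply/andP; split; last first.
  by apply/subv_sumP => k _; apply/subvP => x /Aidem_atP[_ /AidemP].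
apply/subvP => x /AidemP xj; rewrite -[x]mul1r -(sum_idem A) mulr_suml.
by apply: memv_sumr => k _; rewrite -xj mulrA Aidem_at_sandwich.
Qed.

(** The sum is direct: left multiplication by [e_k] isolates the k-th term of a vanishing sum. *)
Lemma dim_Aidem j : \dim (Aidem A j) = (\sum_k \dim (Aidem_at A j k))%N.
Proof.
rewrite Aidem_sum; apply/directvP/directv_sum_independent => x hx sx0 k _.
have /Aidem_atP[<- _] := hx k isT; rewrite -(mulr0 (idem A k)) -sx0 mulr_sumr.
rewrite (bigD1 k) //= big1 ?addr0 // => l lk.
have /Aidem_atP[<- _] := hx l isT.
by rewrite mulrA idemM eq_sym (negbTE lk) mul0r.
Qed.

Lemma fullv_sum : fullv = (\sum_j Aidem A j)%VS.
Proof.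
apply/eqP; rewrite eqEsubv subvf andbT; apply/subvP => x _.
rewrite -[x]mulr1 -(sum_idem A) mulr_sumr.
by apply: memv_sumr => j _; apply/AidemP; rewrite -mulrA idemK.
Qed.

Lemma dim_fullv : \dim (fullv : {vspace A}) = (\sum_j \dim (Aidem A j))%N.
Proof.
rewrite fullv_sum; apply/directvP/directv_sum_independent => x hx sx0 k _.
have /AidemP <- := hx k isT; rewrite -(mul0r (idem A k)) -sx0 mulr_suml.
rewrite (bigD1 k) //= big1 ?addr0 // => l lk.
have /AidemP <- := hx l isT.
by rewrite -mulrA idemM (negbTE lk) mulr0.
Qed.

End DirectSums.

(** * From the axioms to the three bases *)

Lemma sub_span_image (K : fieldType) (E : vectType K) (T T' : finType) (P : pred T)
    (P' : pred T') (f : T -> E) (f' : T' -> E) (h : T -> T') :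
  (forall x, P x -> P' (h x)) -> (forall x, P x -> f' (h x) = f x) ->
  (<<[seq f x | x in P]>> <= <<[seq f' x | x in P']>>)%VS.
Proof.
move=> hP hf; apply: sub_span => _ /imageP[x Px ->].
by rewrite -hf //; apply: image_f; exact: hP.
Qed.

Lemma one_quasi_hereditary_span_dim (K : fieldType) (d : Order.disp_t)
    (V : finPOrderType d) (Q : quiver V) (A : bqalg K Q) (j k : V) :
  one_quasi_hereditary A ->
  (forall p : V -> A,
    (forall i, (j <= i)%O -> (k <= i)%O -> is_pjik j i k (p i)) ->
    (Aidem_at A j k <= <<[seq p i | i in [pred i : V | (j <= i)%O && (k <= i)%O]]>>)%VS) /\
  \dim (Aidem_at A j k) = #|[pred i : V | (j <= i)%O && (k <= i)%O]|.
Proof.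
case=> Delta [nabla [[std qh] costd [bot [top [le_bt mult _ emb]]]]].
(* Condition (2) gives the entries 1; the zeros come from the support of Delta(i) and, for [filtD],
   from quasi-heredity. *)
have wdimD i l : wdim (Delta i) l = (l <= i)%O.
  apply/jh_multE; have [li|li] := boolP (l <= i)%O; first by have [] := mult i l li.
  by have [h _] := std i; exact: h.
have filtD l i : filt_mult Delta (Pmod A l) i (l <= i)%O.
  have [li|li] := boolP (l <= i)%O; first by have [] := mult i l li.
  by have [_ _ h _] := qh l i; exact: h.
split=> [p hp|]; last exact: (dim_Aidem_at wdimD filtD).
apply: (@span_pjik _ _ _ _ _ Delta std wdimD filtD nabla top) => //.
- by move=> i; have /andP[] := le_bt i.
- by move=> i; have [] := emb i.
- by move=> i; have [] := emb i.
Qed.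

Theorem theorem3p2 (K : closedFieldType) (d : Order.disp_t) (V : finPOrderType d)
    (Q : quiver V) (A : bqalg K Q) (hA : one_quasi_hereditary A) :
  [/\ forall (j k : V) (p : V -> A),
        (forall i, (j <= i)%O -> (k <= i)%O -> is_pjik j i k (p i)) ->
        basis_of (Aidem_at A j k)
          [seq p i | i in [pred i : V | (j <= i)%O && (k <= i)%O]],
      forall (j : V) (p : V -> V -> A),
        (forall i k, (j <= i)%O -> (k <= i)%O -> is_pjik j i k (p i k)) ->
        basis_of (Aidem A j)
          [seq p x.1 x.2 | x in [pred x : V * V | (j <= x.1)%O && (x.2 <= x.1)%O]]
    & forall p : V -> V -> V -> A,
        (forall j i k, (j <= i)%O -> (k <= i)%O -> is_pjik j i k (p j i k)) ->
        basis_of (fullv : {vspace A})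
          [seq p x.1.1 x.1.2 x.2 |
            x in [pred x : V * V * V | (x.1.1 <= x.1.2)%O && (x.2 <= x.1.2)%O]]].
Proof.
have spn j k := (one_quasi_hereditary_span_dim j k hA).1.
have dm j k := (one_quasi_hereditary_span_dim j k hA).2.
have dmj j : \dim (Aidem A j) =
    #|[pred x : V * V | (j <= x.1)%O && (x.2 <= x.1)%O]|.
  (* Summing over [k] the number of admissible [i] counts the pairs [(i, k)]. *)
  rewrite dim_Aidem -sum1_card; under eq_bigr do rewrite dm -sum1_card.
  rewrite (exchange_big_dep predT) //= pair_big_dep /=.
  by apply: eq_bigl => x; rewrite !inE.
have spnj j p : (forall i k, (j <= i)%O -> (k <= i)%O -> is_pjik j i k (p i k)) ->
    (Aidem A j <=
      <<[seq p x.1 x.2 | x in [pred x : V * V | (j <= x.1)%O && (x.2 <= x.1)%O]]>>)%VS.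
  move=> hp; rewrite Aidem_sum; apply/subv_sumP => k _.
  apply: subv_trans (spn j k (p^~ k) _) _ => [i ji ki|]; first exact: hp.
  by apply: (@sub_span_image _ _ _ _ _ _ _ _ (fun i => (i, k))).
(* A spanning family with no more members than the dimension is a basis, so each claim splits into
   spanning and a count. *)
split=> [j k p hp|j p hp|p hp]; rewrite basisEdim size_image.
- by rewrite dm leqnn andbT; exact: spn.
- by rewrite dmj leqnn andbT; exact: spnj.
apply/andP; split.
  rewrite fullv_sum; apply/subv_sumP => j _.
  apply: subv_trans (spnj j (p j) _) _ => [i k|]; first exact: hp.
  by apply: (@sub_span_image _ _ _ _ _ _ _ _ (fun x => (j, x.1, x.2))).
rewrite dim_fullv; under eq_bigr do rewrite dmj -sum1_card.
rewrite -sum1_card pair_big_dep /=.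
rewrite (reindex (fun x : V * V * V => (x.1.1, (x.1.2, x.2)))) /=; last first.
  by exists (fun y : V * (V * V) => (y.1, y.2.1, y.2.2)) => [[[? ?] ?]|[? [? ?]]] _.
by rewrite leq_eqVlt; apply/orP; left; apply/eqP; apply: eq_bigl => x; rewrite !inE.
Qed.
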